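(* There is a tomography algorithm that, given query access to an unknown unitary $Z\in\mathrm{U}(d)$ and parameters $\varepsilon,\eta>0$, applies $Z$ at most $O(d^2/\varepsilon^2)\cdot\log(1/\eta)$ times and outputs an estimate $V\in\mathrm{U}(d)$ satisfying $\operatorname{pudist}(Z,V)\le\varepsilon$ except with probability at most $\eta$. The algorithm uses only a $d$-dimensional Hilbert space (in particular only $n$ qubits when $d=2^n$).
   Context: $\operatorname{pudist}(U,V)=\min_{\phi\in\mathrm{U}(1)}\|\phi U-V\|_{\mathrm{op}}$, with $\|\cdot\|_{\mathrm{op}}$ the operator norm and $\mathrm{U}(1)$ the unit complex numbers.
   Formalization: The failure probability η is restricted to 0 < η ≤ 1/2: for η > 1 the bound with log(1/η) is negative, and for η close to 1 it would allow no queries at all; values of η bounded below 1 follow from η = 1/2 with a larger constant. *)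

(* Defs.v *)
From HB Require Import structures.
From mathcomp Require Import all_boot all_order all_algebra.
From mathcomp Require Import boolp classical_sets reals exp.
From mathcomp Require Import complex.
Set Implicit Arguments. Unset Strict Implicit. Unset Printing Implicit Defensive.
Import Order.TTheory GRing.Theory Num.Theory.
Local Open Scope classical_set_scope.
Local Open Scope ring_scope.

Section Quantum.
Variable R : realType.
Local Notation C := (complex R).

Definition adj (m n : nat) (A : 'M[C]_(m, n)) : 'M[C]_(n, m) :=
  \matrix_(i, j) conjc (A j i).

Definition unitary (d : nat) (U : 'M[C]_d) : Prop := adj U *m U = 1%:M.

Definition cabs (z : C) : R := Num.sqrt (@complex.Re R z ^+ 2 + @complex.Im R z ^+ 2).

Definition vnorm (d : nat) (v : 'cV[C]_d) : R :=
  Num.sqrt (\sum_i (@complex.Re R (v i 0) ^+ 2 + @complex.Im R (v i 0) ^+ 2)).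

Definition opnorm (d : nat) (A : 'M[C]_d) : R :=
  sup [set vnorm (A *m v) | v in [set v : 'cV[C]_d | vnorm v = 1]].

(* pudist(U,V) = min_{phi in U(1)} ||phi U - V||_op  (the min is attained by
   compactness of U(1), so it equals the infimum used here) *)
Definition pudist (d : nat) (U V : 'M[C]_d) : R :=
  inf [set opnorm (phi *: U - V) | phi in [set phi : C | cabs phi = 1]].

(* Query algorithms acting on a d-dimensional Hilbert space only, with
   classical adaptivity.  The quantum memory is a density matrix on C^d.
   - [Output V]          : stop and output V;
   - [Query a]           : apply the unknown unitary Z (rho |-> Z rho Z^dagger), continue with a;
   - [Instr m K next]    : apply a quantum instrument on C^d with outcomes in 'I_m,
                           outcome i having Kraus operators K i; continue with next i. *)
Inductive alg (d : nat) : Type :=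
  | Output of 'M[C]_d
  | Query of alg d
  | Instr (m : nat) of ('I_m -> seq 'M[C]_d) & ('I_m -> alg d).

Fixpoint wf_alg (d : nat) (a : alg d) : Prop :=
  match a with
  | Output V => unitary V
  | Query a' => wf_alg a'
  | Instr m K next =>
      (\sum_(i < m) \sum_(k <- K i) adj k *m k = 1%:M) /\
      (forall i, wf_alg (next i))
  end.

Fixpoint queries (d : nat) (a : alg d) : nat :=
  match a with
  | Output _ => 0%N
  | Query a' => (queries a').+1
  | Instr m _ next => \max_(i < m) queries (next i)
  end.

(* probability (Born rule) that the output satisfies P, when running a with
   unknown unitary Z from the (unnormalized) state rho *)
Fixpoint prob_from (d : nat) (Z : 'M[C]_d) (P : 'M[C]_d -> Prop)
    (a : alg d) (rho : 'M[C]_d) : R :=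
  match a with
  | Output V => if asbool (P V) then @complex.Re R (\tr rho) else 0
  | Query a' => prob_from Z P a' (Z *m rho *m adj Z)
  | Instr m K next =>
      \sum_(i < m) prob_from Z P (next i) (\sum_(k <- K i) k *m rho *m adj k)
  end.

(* the algorithm starts from the maximally mixed state (irrelevant: instruments
   can re-prepare any state) *)
Definition prob (d : nat) (Z : 'M[C]_d) (P : 'M[C]_d -> Prop) (a : alg d) : R :=
  prob_from Z P a ((d%:R)^-1 *: 1%:M).

End Quantum.

(* Main.v *)
Require Import Defs.
From HB Require Import structures.
From mathcomp Require Import all_boot all_order all_algebra.
From mathcomp Require Import boolp classical_sets reals sequences exp.
From mathcomp Require Import complex.
From mathcomp Require Import ring lra zify.
Import Order.TTheory GRing.Theory Num.Theory.
Local Open Scope ring_scope.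
Set Implicit Arguments. Unset Strict Implicit. Unset Printing Implicit Defensive.

(** One round prepares e_0 + θ e_j, with j a uniformly random coordinate and θ a
    random fourth root of unity, applies Z once, and measures the POVM
    { 8^-d s s^* }, where the entries of s are independent and have the moments of
    a complex Gaussian up to order (2,2).  For vectors u, w, v the statistic
    2 d v_j conj(θ) (w^* s) (s^* u) then has expectation
    v_0 <w, u> + <Z e_0, u> <w, Z v>: the column Z e_0 acts as a phase reference
    for the whole matrix Z.  The statistic has variance O(d) and
    sub-exponential tails at scale d, so after N = C (d / τ)^2 ln(1/η)
    rounds its empirical means are within τ of their expectations
    simultaneously for all (u, w, v) in the cube of an exp(O(d))-point net of the
    unit ball, except with probability η.  The estimate is any unitary V whose
    expected statistics agree with the data.  Taking for u a net point close to V e_0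
    shows that a Z - g V has operator norm O(τ) for some scalars a, g with
    |g| >= 1/2, whence pudist Z V = O(τ). *)

(** * Complex numbers and vectors *)

Section ComplexVectors.
Variable R : realType.
Local Notation C := (complex R).
Local Notation Re := (@complex.Re R).
Local Notation Im := (@complex.Im R).
Local Notation "x %:C" := (real_complex R x).

Definition nsq (z : C) : R := Re z ^+ 2 + Im z ^+ 2.

Lemma ReD (x y : C) : Re (x + y) = Re x + Re y.
Proof. by case: x y => [a b] [c d]. Qed.

Lemma ReN (x : C) : Re (- x) = - Re x.
Proof. by case: x. Qed.

Lemma ReB (x y : C) : Re (x - y) = Re x - Re y.
Proof. by rewrite ReD ReN. Qed.

Lemma Re_rM (k : R) (x : C) : Re (k%:C * x) = k * Re x.
Proof. by case: x => a b /=; rewrite mul0r subr0. Qed.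

Lemma Re_sum (I : Type) (r : seq I) (P : pred I) (F : I -> C) :
  Re (\sum_(i <- r | P i) F i) = \sum_(i <- r | P i) Re (F i).
Proof. by apply: (big_morph Re ReD). Qed.

Lemma nsq_ge0 z : 0 <= nsq z.
Proof. by rewrite addr_ge0 ?sqr_ge0. Qed.

Lemma nsqM x y : nsq (x * y) = nsq x * nsq y.
Proof. by case: x y => [a b] [c d]; rewrite /nsq /=; ring. Qed.

Lemma nsqN x : nsq (- x) = nsq x.
Proof. by case: x => a b; rewrite /nsq /=; ring. Qed.

Lemma nsq_conj x : nsq (conjc x) = nsq x.
Proof. by case: x => a b; rewrite /nsq /=; ring. Qed.

Lemma nsq_real (k : R) : nsq k%:C = k ^+ 2.
Proof. by rewrite /nsq /= expr0n addr0. Qed.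

Lemma nsqE z : (nsq z)%:C = conjc z * z.
Proof.
case: z => a b; rewrite /nsq /=; apply/eqP; rewrite eq_complex /=.
by apply/andP; split; apply/eqP; ring.
Qed.

Lemma nsqD x y : nsq (x + y) = nsq x + nsq y + 2 * Re (conjc x * y).
Proof. by case: x y => [a b] [c d]; rewrite /nsq /=; ring. Qed.

Lemma nsqD_le x y : nsq (x + y) <= 2 * nsq x + 2 * nsq y.
Proof.
case: x y => [a b] [c d]; rewrite /nsq /=.
have := sqr_ge0 (a - c); have := sqr_ge0 (b - d); lra.
Qed.

Lemma Re_sqr_le z : Re z ^+ 2 <= nsq z.
Proof. by rewrite lerDl sqr_ge0. Qed.

Definition dot n (x y : 'cV[C]_n) : C := \sum_i conjc (x i 0) * y i 0.
Definition vnsq n (x : 'cV[C]_n) : R := \sum_i nsq (x i 0).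

Lemma vnsq_ge0 n (x : 'cV[C]_n) : 0 <= vnsq x.
Proof. by apply: sumr_ge0 => i _; exact: nsq_ge0. Qed.

Lemma dotxx n (x : 'cV[C]_n) : dot x x = (vnsq x)%:C.
Proof. by rewrite /dot /vnsq rmorph_sum; apply: eq_bigr => i _; rewrite -nsqE. Qed.

Lemma dotDr n (x y z : 'cV[C]_n) : dot x (y + z) = dot x y + dot x z.
Proof. by rewrite -big_split; apply: eq_bigr => i _; rewrite mxE mulrDr. Qed.

Lemma dotZr n (x y : 'cV[C]_n) k : dot x (k *: y) = k * dot x y.
Proof. by rewrite /dot big_distrr; apply: eq_bigr => i _; rewrite mxE mulrCA. Qed.

Lemma dotNr n (x y : 'cV[C]_n) : dot x (- y) = - dot x y.
Proof. by rewrite -scaleN1r dotZr mulN1r. Qed.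

Lemma dot_conj n (x y : 'cV[C]_n) : conjc (dot x y) = dot y x.
Proof.
rewrite /dot rmorph_sum; apply: eq_bigr => i _.
by rewrite rmorphM /= conjcK mulrC.
Qed.

Lemma dotDl n (x y z : 'cV[C]_n) : dot (x + y) z = dot x z + dot y z.
Proof. by rewrite -dot_conj dotDr rmorphD /= !dot_conj. Qed.

Lemma dotZl n (x y : 'cV[C]_n) k : dot (k *: x) y = conjc k * dot x y.
Proof. by rewrite -dot_conj dotZr rmorphM /= !dot_conj. Qed.

Lemma dotNl n (x y : 'cV[C]_n) : dot (- x) y = - dot x y.
Proof. by rewrite -dot_conj dotNr rmorphN /= !dot_conj. Qed.

Lemma vnsqZ n k (x : 'cV[C]_n) : vnsq (k *: x) = nsq k * vnsq x.
Proof. by rewrite /vnsq big_distrr; apply: eq_bigr => i _; rewrite mxE nsqM. Qed.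

Lemma vnsqN n (x : 'cV[C]_n) : vnsq (- x) = vnsq x.
Proof. by apply: eq_bigr => i _; rewrite mxE nsqN. Qed.

Lemma vnsqD n (x y : 'cV[C]_n) :
  vnsq (x + y) = vnsq x + vnsq y + 2 * Re (dot x y).
Proof.
rewrite /vnsq /dot Re_sum big_distrr -!big_split; apply: eq_bigr => i _ /=.
by rewrite mxE nsqD.
Qed.

Lemma vnsq0_eq0 n (x : 'cV[C]_n) : vnsq x = 0 -> x = 0.
Proof.
move=> /eqP; rewrite psumr_eq0 => [/allP h|i _]; last exact: nsq_ge0.
apply/colP => i; rewrite mxE.
have /h : i \in index_enum (ordinal n) by rewrite mem_index_enum.
rewrite /= paddr_eq0 ?sqr_ge0 // !sqrf_eq0.
by case: (x i 0) => a b /= /andP[/eqP -> /eqP ->].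
Qed.

Lemma Re_dot_sqr_le n (x y : 'cV[C]_n) : Re (dot x y) ^+ 2 <= vnsq x * vnsq y.
Proof.
have [/vnsq0_eq0 -> |y0] := eqVneq (vnsq y) 0.
  rewrite /dot big1 => [|i _]; last by rewrite mxE mulr0.
  by rewrite expr0n mulr_ge0 ?vnsq_ge0.
have yp : 0 < vnsq y by rewrite lt_neqAle eq_sym y0 vnsq_ge0.
(* The squared norm of |y|^2 x - Re<x,y> y equals |y|^2 (|x|^2 |y|^2 - Re<x,y>^2). *)
have := vnsq_ge0 ((vnsq y)%:C *: x + (- Re (dot x y))%:C *: y).
rewrite vnsqD !vnsqZ !nsq_real dotZl dotZr conjc_real !Re_rM => h.
rewrite -(ler_pM2l yp) -subr_ge0; apply: le_trans h _; rewrite le_eqVlt.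
by apply/orP; left; apply/eqP; ring.
Qed.

Lemma vnormE n (x : 'cV[C]_n) : vnorm x = Num.sqrt (vnsq x).
Proof. by []. Qed.

Lemma vnorm_ge0 n (x : 'cV[C]_n) : 0 <= vnorm x.
Proof. exact: sqrtr_ge0. Qed.

Lemma vnorm_sqr n (x : 'cV[C]_n) : vnorm x ^+ 2 = vnsq x.
Proof. by rewrite sqr_sqrtr ?vnsq_ge0. Qed.

Lemma vnorm1 n (x : 'cV[C]_n) : (vnorm x = 1) <-> (vnsq x = 1).
Proof.
split=> h; first by rewrite -vnorm_sqr h expr1n.
by rewrite vnormE h sqrtr1.
Qed.

Lemma Re_dot_le n (x y : 'cV[C]_n) : `|Re (dot x y)| <= vnorm x * vnorm y.
Proof.
rewrite -[leLHS]sqrtr_sqr /vnorm -sqrtrM ?vnsq_ge0 // ler_wsqrtr //.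
exact: Re_dot_sqr_le.
Qed.

Lemma vnormD n (x y : 'cV[C]_n) : vnorm (x + y) <= vnorm x + vnorm y.
Proof.
rewrite -(@ler_pXn2r _ 2) ?nnegrE ?addr_ge0 ?vnorm_ge0 //.
rewrite vnorm_sqr vnsqD -!vnorm_sqr.
have := Re_dot_le x y; have := ler_norm (Re (dot x y)); lra.
Qed.

Lemma cabs_ge0 (z : C) : 0 <= cabs z.
Proof. exact: sqrtr_ge0. Qed.

Lemma cabs_sqr (z : C) : cabs z ^+ 2 = nsq z.
Proof. by rewrite sqr_sqrtr ?nsq_ge0. Qed.

Lemma cabs_real (k : R) : cabs k%:C = `|k|.
Proof. by rewrite -sqrtr_sqr -nsq_real. Qed.

Lemma Re_le_cabs (z : C) : `|Re z| <= cabs z.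
Proof. by rewrite -[leLHS]sqrtr_sqr ler_wsqrtr // Re_sqr_le. Qed.

Lemma cabsM (x y : C) : cabs (x * y) = cabs x * cabs y.
Proof. by rewrite /cabs -!/(nsq _) nsqM sqrtrM ?nsq_ge0. Qed.

Lemma vnormZ n k (x : 'cV[C]_n) : vnorm (k *: x) = cabs k * vnorm x.
Proof. by rewrite !vnormE vnsqZ sqrtrM ?nsq_ge0. Qed.

Lemma vnormN n (x : 'cV[C]_n) : vnorm (- x) = vnorm x.
Proof. by rewrite !vnormE vnsqN. Qed.

Lemma vnormB n (x y : 'cV[C]_n) : vnorm (x - y) <= vnorm x + vnorm y.
Proof. by rewrite -[vnorm y]vnormN vnormD. Qed.

Lemma vnorm_normalize n (x : 'cV[C]_n) :
  exists2 y : 'cV[C]_n, x = (vnorm x)%:C *: y & (vnorm x != 0 -> vnorm y = 1).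
Proof.
have [x0|x0] := eqVneq (vnorm x) 0.
  exists 0 => //; rewrite scaler0; apply: vnsq0_eq0.
  by rewrite -vnorm_sqr x0 expr0n.
exists ((vnorm x)^-1%:C *: x).
  by rewrite scalerA -rmorphM /= divff // scale1r.
by rewrite vnormZ cabs_real ger0_norm ?invr_ge0 ?vnorm_ge0 // mulVf.
Qed.

Lemma dotE n (x y : 'cV[C]_n) : dot x y = (adj x *m y) 0 0.
Proof. by rewrite mxE; apply: eq_bigr => i _; rewrite mxE. Qed.

Lemma adjM m n p (A : 'M[C]_(m, n)) (B : 'M[C]_(n, p)) :
  adj (A *m B) = adj B *m adj A.
Proof.
apply/matrixP => i j; rewrite !mxE rmorph_sum; apply: eq_bigr => k _.
by rewrite !mxE rmorphM /= mulrC.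
Qed.

Lemma dot_unitary d (U : 'M[C]_d) (x y : 'cV[C]_d) :
  unitary U -> dot (U *m x) (U *m y) = dot x y.
Proof. by move=> hU; rewrite !dotE adjM mulmxA -(mulmxA _ _ U) hU mulmx1. Qed.

Lemma vnsq_unitary d (U : 'M[C]_d) (x : 'cV[C]_d) :
  unitary U -> vnsq (U *m x) = vnsq x.
Proof. by move=> hU; apply: complexI; rewrite -!dotxx dot_unitary. Qed.

Lemma vnorm_unitary d (U : 'M[C]_d) (x : 'cV[C]_d) :
  unitary U -> vnorm (U *m x) = vnorm x.
Proof. by move=> hU; rewrite !vnormE vnsq_unitary. Qed.

End ComplexVectors.

(** * A random vector with Gaussian moments *)

#[local] Arguments conjc {R} x : simpl never.
#[local] Arguments nsq {R} z : simpl never.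

(** * Elementary inequalities for the exponential *)

Section ExponentialBounds.
Variable R : realType.
Implicit Types x z : R.

(** From exp (- y) >= 1 - y one gets exp y <= 1 / (1 - y) for y < 1. This suffices at y = x when x
    <= 0; for larger x it is too weak, so it is applied at y = x / 2 and squared. *)
Lemma expR_le_quadratic x : `|x| <= 1 -> expR x <= 1 + x + 2 * x ^+ 2.
Proof.
rewrite ler_norml => /andP[x_ge x_le].
have [x0|x0] := leP x 0.
  have h : expR x * (1 - x) <= 1.
    rewrite -[leRHS](expRxMexpNx_1 x) ler_pM2l ?expR_gt0 //.
    exact: expR_ge1Dx.
  rewrite -(@ler_pM2r _ (1 - x)); last by lra.
  apply: le_trans h _; rewrite -subr_ge0.
  have -> : (1 + x + 2 * x ^+ 2) * (1 - x) - 1 = x ^+ 2 * (1 - 2 * x) by ring.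
  by rewrite mulr_ge0 ?sqr_ge0 //; lra.
have e2 : expR x = expR (x / 2) ^+ 2 by rewrite -expRM_natl mulrC divfK ?pnatr_eq0.
have h : expR (x / 2) * (1 - x / 2) <= 1.
  rewrite -[leRHS](expRxMexpNx_1 (x / 2)) ler_pM2l ?expR_gt0 //.
  exact: expR_ge1Dx.
have p : 0 < 1 - x / 2 by lra.
have h2 : (expR (x / 2) * (1 - x / 2)) ^+ 2 <= 1.
  by rewrite expr_le1 // mulr_ge0 ?expR_ge0 // ltW.
rewrite e2 -(@ler_pM2r _ ((1 - x / 2) ^+ 2)) ?exprn_gt0 // -exprMn.
apply: le_trans h2 _; rewrite -subr_ge0.
have -> : (1 + x + 2 * x ^+ 2) * (1 - x / 2) ^+ 2 - 1 =
  x ^+ 2 * ((1 - x) * (5 - 2 * x)) / 4 by field.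
by rewrite divr_ge0 // mulr_ge0 ?sqr_ge0 // mulr_ge0 //; lra.
Qed.

Lemma expR_ge1 x : 0 <= x -> 1 <= expR x.
Proof. by move=> x0; apply: le_trans (expR_ge1Dx x); rewrite lerDl. Qed.

(** Beyond |x| = 1 the quantity x^2 exp |x| dominates both exp x and - x, and the remainder has one
    copy for each. *)
Lemma expR_le_taylor1 x : expR x <= 1 + x + 2 * x ^+ 2 * expR `|x|.
Proof.
have e1 := expR_ge1 (normr_ge0 x).
have [x1|x1] := leP `|x| 1.
  apply: le_trans (expR_le_quadratic x1) _.
  by rewrite lerD2l ler_peMr // mulr_ge0 // sqr_ge0.
have x2 : 1 <= x ^+ 2 by rewrite -real_normK ?num_real // expr_ge1 // ltW.
have xe : `|x| + 1 <= expR `|x| by rewrite addrC expR_ge1Dx.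
have le1 : expR x <= x ^+ 2 * expR `|x|.
  apply: (@le_trans _ _ (expR `|x|)); first by rewrite ler_expR ler_norm.
  by rewrite ler_peMl ?expR_ge0.
have le2 : - x <= x ^+ 2 * expR `|x|.
  apply: (@le_trans _ _ (expR `|x|)); last by rewrite ler_peMl ?expR_ge0.
  have := ler_norm (- x); rewrite normrN; lra.
lra.
Qed.

(** For |z| <= 1 the linear terms of the two quadratic bounds cancel; for |z| > 1 already |z| <= 2
    z^2. *)
Lemma cosh_le z : expR z + expR (- z) <= 2 * expR (2 * z ^+ 2).
Proof.
have [z1|z1] := leP `|z| 1.
  have h1 := expR_le_quadratic z1.
  have h2 : expR (- z) <= 1 + - z + 2 * (- z) ^+ 2.
    by apply: expR_le_quadratic; rewrite normrN.
  have := expR_ge1Dx (2 * z ^+ 2); rewrite sqrrN in h2; lra.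
have h s : `|s| = `|z| -> expR s <= expR (2 * z ^+ 2).
  move=> sz; rewrite ler_expR; apply: le_trans (ler_norm s) _; rewrite sz.
  have -> : z ^+ 2 = `|z| ^+ 2 by rewrite real_normK ?num_real.
  by move: (`|z|) z1 => a; nra.
have := h z erefl; have := h (- z) (normrN z); lra.
Qed.

Lemma le_expR_div x k : 0 < k -> x <= expR (k * x) / k.
Proof.
move=> k0; rewrite ler_pdivlMr // mulrC.
by apply: le_trans (expR_ge1Dx _); rewrite lerDr.
Qed.

(** The sum of the exponents is at most three times the largest of them. This splits a joint
    exponential moment into separate ones. *)
Lemma expR_sum3_le (a b c : R) :
  expR (a + b + c) <= expR (3 * a) + expR (3 * b) + expR (3 * c).
Proof.
have pa := expR_ge0 (3 * a); have pb := expR_ge0 (3 * b).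
have pc := expR_ge0 (3 * c).
have [ab|ab] := leP a b; have [bc|bc] := leP b c; have [ac|ac] := leP a c;
  try (by exfalso; lra);
  [apply: (@le_trans _ _ (expR (3 * c)))|apply: (@le_trans _ _ (expR (3 * b)))
  |apply: (@le_trans _ _ (expR (3 * b)))|apply: (@le_trans _ _ (expR (3 * c)))
  |apply: (@le_trans _ _ (expR (3 * a)))|apply: (@le_trans _ _ (expR (3 * a)))];
  by [rewrite ler_expR; lra|lra].
Qed.

End ExponentialBounds.

(** * Moments and exponential moments of the measurement vector *)

Section RandomVector.
Variable R : realType.
Local Notation C := (complex R).
Local Notation Re := (@complex.Re R).
Local Notation "x %:C" := (real_complex R x).

Definition ph (p : bool * bool) : C :=
  (if p.1 then -1 else 1) * (if p.2 then Complex 0 1 else 1).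

Definition site : finType := (bool * (bool * bool))%type.

(* The amplitude is 0 with probability 1/2 and sqrt 2 times a uniform fourth
   root of unity otherwise; its moments up to order (2,2) are those of a
   standard complex Gaussian variable. *)
Definition amp (x : site) : C :=
  if x.1 then (Num.sqrt 2)%:C * ph x.2 else 0.

Lemma sum_ph (V : nmodType) (F : bool * bool -> V) :
  \sum_p F p = F (true, true) + F (true, false) + F (false, true) + F (false, false).
Proof.
rewrite (eq_bigr (fun p => F (p.1, p.2))) => [|[] //].
by rewrite -(pair_bigA _ (fun a b => F (a, b))) /= !big_bool /= !addrA.
Qed.

Lemma sum_site (V : nmodType) (F : site -> V) :
  \sum_x F x = \sum_p F (true, p) + \sum_p F (false, p).
Proof.
rewrite (eq_bigr (fun p => F (p.1, p.2))) => [|[] //].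
by rewrite -(pair_bigA _ (fun a b => F (a, b))) /= big_bool.
Qed.

Lemma sqr_sqrt2C : (Num.sqrt 2)%:C * (Num.sqrt 2)%:C = 2 :> C.
Proof. by rewrite -rmorphM /= -expr2 sqr_sqrtr // rmorph_nat. Qed.

Lemma sqr_iC : Complex 0 1 * Complex 0 1 = -1 :> C.
Proof. by rewrite -expr2 sqr_i. Qed.

(** The conjugate of [ph], written out so that the moment identities become polynomial identities in
    sqrt 2 and i. *)
Definition cph (p : bool * bool) : C :=
  (if p.1 then -1 else 1) * (if p.2 then - Complex 0 1 else 1).

Lemma conjc_ph p : conjc (ph p) = cph p.
Proof.
have ci : conjc (Complex 0 1 : C) = - Complex 0 1.
  by apply/eqP; rewrite eq_complex /= oppr0 !eqxx.
case: p => [a b]; rewrite /ph /cph [fst _]/= [snd _]/= rmorphM; congr (_ * _).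
  by case: a; rewrite ?rmorphN rmorph1.
by case: b; rewrite ?ci ?rmorph1.
Qed.

Lemma amp_true p : amp (true, p) = (Num.sqrt 2)%:C * ph p.
Proof. by []. Qed.

Lemma amp_false p : amp (false, p) = 0.
Proof. by []. Qed.

Lemma conjc_amp_true p : conjc (amp (true, p)) = (Num.sqrt 2)%:C * cph p.
Proof. by rewrite amp_true rmorphM /= conjc_real conjc_ph. Qed.

Lemma conjc_amp_false p : conjc (amp (false, p)) = 0.
Proof. by rewrite amp_false rmorph0. Qed.

(** The induction step in one coordinate: [A] and [B] stand for the contribution of the other
    coordinates. Only E amp = 0 and E |amp|^2 = 1 enter. *)
Lemma site_moment2 (a b A B : C) :
  8^-1 * \sum_x (amp x * a + A) * (conjc (amp x) * b + B) = A * B + a * b.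
Proof.
rewrite sum_site !sum_ph !conjc_amp_true !conjc_amp_false ?amp_true ?amp_false /ph /cph /=.
move: sqr_sqrt2C sqr_iC; move: (_%:C) (Complex 0 1) => r i r2 i2.
by field: r2 i2.
Qed.

(** Terms with unequal numbers of [amp] and its conjugate average to 0 over the phase; the last
    coefficient is E |amp|^4 = 2, as for a complex Gaussian. *)
Lemma site_moment4 (a b c e A B D E : C) :
  8^-1 * \sum_x ((amp x * a + A) * (conjc (amp x) * b + B)) *
          ((amp x * c + D) * (conjc (amp x) * e + E)) =
  A * B * D * E + a * b * D * E + a * e * B * D + c * b * A * E + c * e * A * B
  + 2 * a * b * c * e.
Proof.
rewrite sum_site !sum_ph !conjc_amp_true !conjc_amp_false ?amp_true ?amp_false /ph /cph /=.
move: sqr_sqrt2C sqr_iC; move: (_%:C) (Complex 0 1) => r i r2 i2.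
by field: r2 i2.
Qed.

Section Average.
Variable F : numFieldType.

(** There are 8 sites, so this is the expectation over independent uniform coordinates. *)
Definition avg n (f : n.-tuple site -> F) : F := 8^-1 ^+ n * \sum_t f t.

Lemma avgS n (f : n.+1.-tuple site -> F) :
  avg f = 8^-1 * \sum_x avg (fun t => f (cons_tuple x t)).
Proof.
rewrite /avg exprS -mulrA -big_distrr /=; congr (_ * (_ * _)).
rewrite pair_bigA /= (reindex (fun p : site * n.-tuple site => cons_tuple p.1 p.2)) //=.
exists (fun t => (thead t, behead_tuple t)) => [[x t] _|t _] /=.
  by rewrite theadE; congr (_, _); apply: val_inj.
by case/tupleP: t => x t; rewrite theadE; apply: val_inj.
Qed.

Lemma avg0 (f : 0.-tuple site -> F) : avg f = f [tuple].
Proof.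
rewrite /avg expr0 mul1r (bigD1 [tuple]) //= big1 ?addr0 // => t /eqP[].
exact: tuple0.
Qed.

Lemma eq_avg n (f g : n.-tuple site -> F) : f =1 g -> avg f = avg g.
Proof. by move=> h; rewrite /avg; under eq_bigr do rewrite h. Qed.

Lemma avgD n (f g : n.-tuple site -> F) :
  avg (fun t => f t + g t) = avg f + avg g.
Proof. by rewrite /avg big_split mulrDr. Qed.

Lemma avgZ n k (f : n.-tuple site -> F) : avg (fun t => k * f t) = k * avg f.
Proof. by rewrite /avg -big_distrr /= mulrCA. Qed.

Lemma avg_sum (I : finType) n (f : I -> n.-tuple site -> F) :
  avg (fun t => \sum_i f i t) = \sum_i avg (f i).
Proof. by rewrite /avg exchange_big /= big_distrr. Qed.

Lemma avg_cst n (k : F) : avg (fun _ : n.-tuple site => k) = k.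
Proof.
have c8 : #|{: site}| = 8%N by rewrite !card_prod !card_bool.
rewrite /avg sumr_const card_tuple c8 -[k *+ _]mulr_natr natrX mulrCA -exprMn.
by rewrite mulVf ?expr1n ?mulr1 ?pnatr_eq0.
Qed.

End Average.

Definition svec n (t : n.-tuple site) : 'cV[C]_n := \col_i amp (tnth t i).

Lemma dot_recl n (a b : 'cV[C]_n.+1) :
  dot a b = conjc (a 0 0) * b 0 0 + dot (row' 0 a) (row' 0 b).
Proof.
rewrite /dot big_ord_recl; congr (_ + _); apply: eq_bigr => i _.
by rewrite !mxE.
Qed.

Lemma vnsq_recl n (a : 'cV[C]_n.+1) :
  vnsq a = nsq (a 0 0) + vnsq (row' 0 a).
Proof.
by rewrite /vnsq big_ord_recl; congr (_ + _); apply: eq_bigr => i _; rewrite !mxE.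
Qed.

Lemma dot_svec_cons n x (t : n.-tuple site) (y : 'cV[C]_n.+1) :
  dot (svec (cons_tuple x t)) y = conjc (amp x) * y 0 0 + dot (svec t) (row' 0 y).
Proof.
rewrite dot_recl mxE tnth0; congr (_ + dot _ _).
by apply/colP => i; rewrite !mxE tnthS.
Qed.

Lemma dot_svec_cons_conj n x (t : n.-tuple site) (y : 'cV[C]_n.+1) :
  dot y (svec (cons_tuple x t)) = amp x * conjc (y 0 0) + dot (row' 0 y) (svec t).
Proof. by rewrite -dot_conj dot_svec_cons rmorphD rmorphM /= conjcK dot_conj. Qed.

Lemma dot0 (a b : 'cV[C]_0) : dot a b = 0.
Proof. by rewrite /dot big_ord0. Qed.

Lemma svec_moment2 n (a b : 'cV[C]_n) :
  avg (fun t : n.-tuple site => dot a (svec t) * dot (svec t) b) = dot a b.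
Proof.
elim: n => [|n IH] in a b *; first by rewrite avg0 !dot0 mul0r.
rewrite avgS -avg_sum -avgZ.
under eq_avg => t.
  under eq_bigr do rewrite dot_svec_cons dot_svec_cons_conj.
  rewrite site_moment2; over.
by rewrite avgD avg_cst IH [dot a b]dot_recl addrC.
Qed.

(** Wick's formula for a standard complex Gaussian vector, by induction on the coordinates. The
    crossed pairing is what later couples the reference column to the rest of Z. *)
Lemma svec_moment4 n (a b w u : 'cV[C]_n) :
  avg (fun t : n.-tuple site => (dot a (svec t) * dot (svec t) b) *
       (dot w (svec t) * dot (svec t) u)) = dot a b * dot w u + dot a u * dot w b.
Proof.
elim: n => [|n IH] in a b w u *; first by rewrite avg0 !dot0; ring.
rewrite avgS -avg_sum -avgZ.
set a0 := conjc (a 0 0); set w0 := conjc (w 0 0).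
pose A (t : n.-tuple site) := dot (row' 0 a) (svec t).
pose B (t : n.-tuple site) := dot (svec t) (row' 0 b).
pose D (t : n.-tuple site) := dot (row' 0 w) (svec t).
pose E (t : n.-tuple site) := dot (svec t) (row' 0 u).
(* Averaging over the first coordinate leaves a quartic term for the induction hypothesis and
   quadratic terms for [svec_moment2]. *)
rewrite (@eq_avg _ _ _ (fun t => (A t * B t) * (D t * E t)
  + ((a0 * b 0 0) * (D t * E t) + ((a0 * u 0 0) * (D t * B t)
  + ((w0 * b 0 0) * (A t * E t) + ((w0 * u 0 0) * (A t * B t)
  + 2 * a0 * b 0 0 * w0 * u 0 0)))))); last first.
  move=> t; under eq_bigr do rewrite !dot_svec_cons !dot_svec_cons_conj.
  by rewrite site_moment4 /A /B /D /E; ring.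
rewrite !avgD avg_cst !avgZ IH !svec_moment2.
rewrite [dot a b]dot_recl [dot w u]dot_recl [dot a u]dot_recl [dot w b]dot_recl.
ring.
Qed.

(** Opposite phases are paired: their cross terms are z and - z, so [cosh_le] replaces them by a
    factor exp (2 z^2). Here |w|^2 = 2 |y|^2 because the nonzero amplitudes have modulus sqrt 2. *)
Lemma site_mgf (c : R) (A y : C) : 0 <= c ->
  8^-1 * \sum_x expR (c * nsq (A + conjc (amp x) * y)) <=
  expR (c * nsq A * (1 + 16 * c * nsq y) + 2 * c * nsq y).
Proof.
move=> c0; set T := expR _.
have q0 := nsq_ge0 y; have a0 := nsq_ge0 A.
have zero : expR (c * nsq A) <= T.
  rewrite ler_expR.
  have -> : c * nsq A * (1 + 16 * c * nsq y) + 2 * c * nsq y =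
     c * nsq A + (16 * (c * nsq A) * (c * nsq y) + 2 * (c * nsq y)) by ring.
  by rewrite lerDl addr_ge0 // !mulr_ge0.
have pm (w : C) : nsq w = 2 * nsq y ->
    expR (c * nsq (A + w)) + expR (c * nsq (A - w)) <= 2 * T.
  move=> wE; set z := 2 * c * Re (conjc A * w).
  have -> : c * nsq (A + w) = c * (nsq A + nsq w) + z by rewrite nsqD /z; ring.
  have -> : c * nsq (A - w) = c * (nsq A + nsq w) + - z.
    by rewrite nsqD nsqN mulrN ReN /z; ring.
  rewrite !expRD -mulrDr.
  apply: le_trans (ler_wpM2l (expR_ge0 _) (cosh_le z)) _.
  rewrite mulrCA -expRD ler_pM2l // ler_expR wE.
  have z2 : z ^+ 2 <= 4 * c ^+ 2 * (nsq A * (2 * nsq y)).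
    rewrite /z exprMn -wE -(nsq_conj A) -nsqM.
    have -> : (2 * c) ^+ 2 = 4 * c ^+ 2 by ring.
    by apply: ler_wpM2l; [rewrite mulr_ge0 ?sqr_ge0|exact: Re_sqr_le].
  have : 2 * z ^+ 2 <= 16 * c * nsq A * (c * nsq y).
    apply: (@le_trans _ _ (2 * (4 * c ^+ 2 * (nsq A * (2 * nsq y))))).
      by rewrite ler_pM2l.
    by rewrite le_eqVlt; apply/orP; left; apply/eqP; ring.
  lra.
have n2 : nsq ((Num.sqrt 2)%:C : C) = 2 by rewrite nsq_real sqr_sqrtr.
have ni : nsq (Complex 0 1 : C) = 1 by rewrite /nsq /= expr0n expr1n add0r.
have p1 := pm ((Num.sqrt 2)%:C * y); rewrite nsqM n2 in p1.
have p2 := pm ((Num.sqrt 2)%:C * Complex 0 1 * y).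
rewrite !nsqM n2 ni mulr1 in p2.
have {}p1 := p1 erefl; have {}p2 := p2 erefl.
rewrite sum_site !sum_ph !conjc_amp_true !conjc_amp_false /cph /=.
rewrite mul0r addr0 !mulN1r !mul1r !mulr1 ?opprK ?mulrN ?mulrN1 ?mulNr ?mulr1.
lra.
Qed.

(** The offset [A] carries the part of the inner product due to coordinates already fixed, which
    makes the induction on coordinates close. *)
Lemma svec_mgf n (y : 'cV[C]_n) (c : R) (A : C) : 0 < c -> 16 * c * vnsq y < 1 ->
  avg (fun t : n.-tuple site => expR (c * nsq (A + dot (svec t) y))) <=
  expR ((c * nsq A + 2 * c * vnsq y) / (1 - 16 * c * vnsq y)).
Proof.
elim: n => [|n IH] in y A *.
  by move=> c0 _; rewrite avg0 dot0 addr0 /vnsq big_ord0 !mulr0 subr0 addr0 invr1 mulr1.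
move=> c0; rewrite vnsq_recl; set q := nsq _; set Y := vnsq _ => hc.
have q0 : 0 <= q by exact: nsq_ge0.
have Y0 : 0 <= Y by exact: vnsq_ge0.
have cq0 : 0 <= c * q by rewrite mulr_ge0 // ltW.
have cY0 : 0 <= c * Y by rewrite mulr_ge0 // ltW.
have hY : 0 < 1 - 16 * c * Y by lra.
rewrite avgS; set c' := c / (1 - 16 * c * Y).
have c'0 : 0 < c' by rewrite divr_gt0.
have step x : avg (fun t : n.-tuple site => expR (c * nsq (A + dot (svec (cons_tuple x t)) y)))
    <= expR (2 * c' * Y) * expR (c' * nsq (A + conjc (amp x) * y 0 0)).
  under eq_avg do rewrite dot_svec_cons addrA.
  apply: le_trans (IH _ _ c0 _) _; first by rewrite -/Y; lra.
  rewrite -expRD ler_expR -/Y /c' le_eqVlt; apply/orP; left; apply/eqP.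
  by field; rewrite gt_eqF.
apply: (@le_trans _ _ (8^-1 * \sum_x
   expR (2 * c' * Y) * expR (c' * nsq (A + conjc (amp x) * y 0 0)))).
  by rewrite ler_pM2l ?invr_gt0 //; apply: ler_sum => x _; exact: step.
rewrite -big_distrr /= mulrCA.
apply: le_trans (ler_wpM2l (expR_ge0 _) (site_mgf _ _ (ltW c'0))) _.
rewrite -expRD ler_expR -/q.
have hc2 : 0 < 1 - 16 * c * (q + Y) by lra.
set c'' := c / (1 - 16 * c * (q + Y)).
have -> : (c * nsq A + 2 * c * (q + Y)) / (1 - 16 * c * (q + Y)) =
   c'' * nsq A + 2 * c'' * (q + Y) by rewrite /c''; field; rewrite gt_eqF.
(* The rates compose exactly: c' / (1 - 16 c' q) = c''. The claim is therefore 1 + x <= 1 / (1 - x)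
   at x = 16 c' q. *)
have h1 : c' * (1 + 16 * c' * q) <= c''.
  rewrite -subr_ge0 /c' /c''.
  have -> : c / (1 - 16 * c * (q + Y)) -
      c / (1 - 16 * c * Y) * (1 + 16 * (c / (1 - 16 * c * Y)) * q) =
      c * (16 * (c * q)) ^+ 2 / ((1 - 16 * c * (q + Y)) * (1 - 16 * c * Y) ^+ 2).
    by field; rewrite !gt_eqF.
  by rewrite divr_ge0 ?mulr_ge0 ?sqr_ge0 // ltW.
have h2 : c' <= c''.
  apply: le_trans h1; apply: ler_peMr; first exact: ltW.
  by rewrite lerDl; apply: mulr_ge0 => //; apply: mulr_ge0 => //; exact: ltW.
have a0 := nsq_ge0 A.
have := ler_wpM2r a0 h1; have := ler_wpM2r q0 h2; have := ler_wpM2r Y0 h2.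
lra.
Qed.

Lemma svec_subgaussian n (y : 'cV[C]_n) (c : R) : 0 < c -> c <= 32^-1 ->
  vnsq y <= 1 ->
  avg (fun t : n.-tuple site => expR (c * nsq (dot (svec t) y))) <= 2.
Proof.
move=> c0 c1 y1; have y0 := vnsq_ge0 y.
have cy : c * vnsq y <= 32^-1.
  by apply: le_trans c1; rewrite ler_piMr // ltW.
have := @svec_mgf n y c 0 c0.
under eq_avg do rewrite add0r.
have -> : nsq (0 : C) = 0 by rewrite /nsq /= expr0n addr0.
rewrite mulr0 add0r => h; apply: le_trans (h _) _; first by lra.
(* The exponent is at most (2 / 32) / (1 - 1 / 2), and exp (1/2) <= 2 follows from exp (- 1/2) >=
   1/2. *)
apply: (@le_trans _ _ (expR 2^-1)).
  by rewrite ler_expR ler_pdivrMr; lra.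
have : (1 - 2^-1 : R) <= expR (- 2^-1) by exact: expR_ge1Dx.
have := expRxMexpNx_1 (2^-1 : R); have := expR_gt0 (2^-1 : R).
by move: (expR _) (expR _) => e f; nra.
Qed.

End RandomVector.

(** * Independent rounds *)

Section ProductExpectation.
Variables (R : realType) (Omega : finType) (p : Omega -> R).
Implicit Types (F G : seq Omega -> R) (Y : Omega -> R).

(** Expectation over n independent draws, unfolded one draw at a time to match the recursion of
    [rounds]. *)
Fixpoint iidE n F : R :=
  if n is n'.+1 then \sum_w p w * iidE n' (fun l => F (w :: l)) else F [::].

Lemma iidE_sum n (I : Type) (r : seq I) (F : I -> seq Omega -> R) :
  iidE n (fun l => \sum_(i <- r) F i l) = \sum_(i <- r) iidE n (F i).
Proof.
elim: n F => [//|n IH] F /=; rewrite exchange_big /=; apply: eq_bigr => w _.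
by rewrite IH big_distrr.
Qed.

Lemma iidED n F G : iidE n (fun l => F l + G l) = iidE n F + iidE n G.
Proof.
elim: n F G => [//|n IH] F G /=; rewrite -big_split; apply: eq_bigr => w _ /=.
by rewrite IH mulrDr.
Qed.

Lemma iidEZ n k F : iidE n (fun l => k * F l) = k * iidE n F.
Proof.
elim: n F => [//|n IH] F /=; rewrite big_distrr; apply: eq_bigr => w _ /=.
by rewrite IH mulrCA.
Qed.

Lemma iidE_expR n Y :
  iidE n (fun l => expR (\sum_(w <- l) Y w)) = (\sum_w p w * expR (Y w)) ^+ n.
Proof.
elim: n => [|n IH] /=; first by rewrite big_nil expR0.
rewrite exprS -IH big_distrl; apply: eq_bigr => w _ /=.
rewrite -[RHS]mulrA -[in RHS](iidEZ n (expR _)); congr (_ * iidE n _); apply/funext => l.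
by rewrite big_cons expRD.
Qed.

Hypotheses (p_ge0 : forall w, 0 <= p w) (p_sum : \sum_w p w = 1).

Lemma iidE_cst n k : iidE n (fun=> k) = k.
Proof.
elim: n => [//|n IH] /=.
by under eq_bigr do rewrite IH; rewrite -big_distrl /= p_sum mul1r.
Qed.

Lemma le_iidE n F G : (forall l, size l = n -> F l <= G l) ->
  iidE n F <= iidE n G.
Proof.
elim: n F G => [|n IH] F G h /=; first exact: h.
apply: ler_sum => w _; apply: ler_wpM2l => //.
by apply: IH => l sl; apply: h; rewrite /= sl.
Qed.

(** Bernstein's argument: the mean of [expR_le_taylor1] at s Y is at most 1 + s m + 2 s^2 B, hence
    at most exp (s m + 2 s^2 B), and centring removes s m. *)
Lemma mgf_le Y (B s : R) :
  \sum_w p w * (Y w ^+ 2 * expR (`|s| * `|Y w|)) <= B ->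
  \sum_w p w * expR (s * (Y w - \sum_w p w * Y w)) <= expR (2 * s ^+ 2 * B).
Proof.
set m := \sum_w p w * Y w => hB.
have -> : \sum_w p w * expR (s * (Y w - m)) =
    expR (- (s * m)) * \sum_w p w * expR (s * Y w).
  rewrite big_distrr; apply: eq_bigr => w _ /=.
  by rewrite mulrBr expRD mulrA mulrC.
have h : \sum_w p w * expR (s * Y w) <= 1 + (s * m + 2 * s ^+ 2 * B).
  apply: (@le_trans _ _ (\sum_w (p w + (s * (p w * Y w) + 2 * s ^+ 2 *
      (p w * (Y w ^+ 2 * expR (`|s| * `|Y w|))))))).
    apply: ler_sum => w _.
    have := ler_wpM2l (p_ge0 w) (expR_le_taylor1 (s * Y w)).
    rewrite normrM exprMn => h; apply: le_trans h _.
    by rewrite le_eqVlt; apply/orP; left; apply/eqP; ring.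
  rewrite !big_split /= p_sum -!big_distrr /= !lerD2l.
  by rewrite ler_wpM2l // mulr_ge0 ?sqr_ge0.
apply: (@le_trans _ _ (expR (- (s * m)) * expR (s * m + 2 * s ^+ 2 * B))).
  apply: ler_wpM2l; rewrite ?expR_ge0 //; apply: le_trans h _.
  exact: expR_ge1Dx.
by rewrite -expRD addrA addNr add0r.
Qed.

Lemma chernoff n Y (B tau : R) : 0 < B -> 0 <= tau ->
  \sum_w p w * (Y w ^+ 2 * expR (tau / (4 * B) * `|Y w|)) <= B ->
  iidE n (fun l => (n%:R * tau <
     `|\sum_(w <- l) Y w - n%:R * \sum_w p w * Y w|)%R%:R)
  <= 2 * expR (- (n%:R * tau ^+ 2 / (8 * B))).
Proof.
(* The tilt tau / (4 B) minimises 2 s^2 B - s tau, with minimum - tau^2 / (8 B). *)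
move=> B0 t0 hB; set m := \sum_w p w * Y w; set lam := tau / (4 * B).
have lam0 : 0 <= lam by rewrite divr_ge0 // mulr_ge0 // ltW.
have side s : `|s| = lam ->
    iidE n (fun l => expR (- (lam * n%:R * tau)) *
       expR (\sum_(w <- l) s * (Y w - m))) <= expR (- (n%:R * tau ^+ 2 / (8 * B))).
  move=> sl; rewrite iidEZ iidE_expR.
  apply: (@le_trans _ _ (expR (- (lam * n%:R * tau)) * expR (2 * s ^+ 2 * B) ^+ n)).
    apply: ler_wpM2l; rewrite ?expR_ge0 // lerXn2r ?nnegrE ?expR_ge0 //.
      by apply: sumr_ge0 => w _; rewrite mulr_ge0 ?expR_ge0.
    by apply: mgf_le; rewrite sl.
  rewrite -expRM_natl -expRD ler_expR.
  have -> : s ^+ 2 = lam ^+ 2 by rewrite -sl real_normK ?num_real.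
  rewrite le_eqVlt; apply/orP; left; apply/eqP; rewrite /lam; field.
  by rewrite gt_eqF.
(* The indicator of a deviation is at most the sum of the two exponential tilts, one per sign. *)
apply: (@le_trans _ _ (iidE n (fun l =>
    expR (- (lam * n%:R * tau)) * expR (\sum_(w <- l) lam * (Y w - m))
    + expR (- (lam * n%:R * tau)) * expR (\sum_(w <- l) - lam * (Y w - m))))).
  apply: le_iidE => l sl.
  rewrite -!expRD -!big_distrr /= sumrB big_const_seq count_predT sl.
  rewrite iter_addr_0 -[m *+ n]mulr_natl; set D := _ - _.
  have [h|_] := ltP; last by rewrite mulr0n addr_ge0 ?expR_ge0.
  have [D0|D0] := leP 0 D.
    rewrite ger0_norm // in h; apply: (@le_trans _ _ (expR (lam * D - lam * n%:R * tau))).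
      by apply: expR_ge1; rewrite -mulrA -mulrBr mulr_ge0 // subr_ge0 ltW.
    by rewrite addrC lerDl expR_ge0.
  rewrite ltr0_norm // in h; apply: (@le_trans _ _ (expR (- lam * D - lam * n%:R * tau))).
    by apply: expR_ge1; rewrite mulNr -mulrN -mulrA -mulrBr mulr_ge0 // subr_ge0 ltW.
  by rewrite [- lam * D - _]addrC lerDr expR_ge0.
rewrite iidED mulr_natl mulr2n; apply: lerD; apply: side.
  by rewrite ger0_norm.
by rewrite normrN ger0_norm.
Qed.

End ProductExpectation.

(** * The outcome law of one round and the mean of the statistic *)

Section RoundDistribution.
Variables (R : realType) (k : nat).
Local Notation d := k.+1.
Local Notation C := (complex R).
Local Notation Re := (@complex.Re R).
Local Notation "x %:C" := (real_complex R x).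

Definition input : finType := ('I_d * (bool * bool))%type.
Definition outcome : finType := (input * d.-tuple site)%type.

Definition bas (j : 'I_d) : 'cV[C]_d := delta_mx j 0.

Definition inp (i : input) : 'cV[C]_d := bas 0 + ph R i.2 *: bas i.1.

(* For j = 0 the vector e_0 + th e_0 may vanish; as the average of |e_0 + th e_j|^2
   over th is 2 for every j, the weights below still sum to 1. *)
Definition pZ (Z : 'M[C]_d) (w : outcome) : R :=
  (8 * d%:R)^-1 * (8^-1 ^+ d * nsq (dot (svec R w.2) (Z *m inp w.1))).

(** The factor 2 d offsets the input weight 1 / (8 d) together with the factor 4 of [sum_ph_polar].
    The real part suffices, since [net_opnorm_le] asks for bounds on Re <w, M v> only. *)
Definition stat (u w v : 'cV[C]_d) (o : outcome) : R :=
  Re ((2 * d%:R)%:C * (v o.1.1 0 * conjc (ph R o.1.2)) *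
      (dot w (svec R o.2) * dot (svec R o.2) u)).

Definition mean (Z : 'M[C]_d) (u w v : 'cV[C]_d) : R :=
  Re (v 0 0 * dot w u + dot (Z *m bas 0) u * dot w (Z *m v)).

Lemma sum_input (V : nmodType) (F : input -> V) :
  \sum_i F i = \sum_j \sum_t F (j, t).
Proof. by rewrite pair_bigA; apply: eq_bigr => -[]. Qed.

Lemma sum_outcome (F : input -> d.-tuple site -> R) :
  \sum_(w : outcome) (8 * d%:R)^-1 * (8^-1 ^+ d * F w.1 w.2) =
  (8 * d%:R)^-1 * \sum_i avg (F i).
Proof.
rewrite -(pair_bigA _ (fun i s => (8 * d%:R)^-1 * (8^-1 ^+ d * F i s))) /=.
by rewrite big_distrr; apply: eq_bigr => i _; rewrite -!big_distrr.
Qed.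

Lemma pZ_ge0 Z w : 0 <= pZ Z w.
Proof.
by rewrite !mulr_ge0 ?invr_ge0 ?mulr_ge0 ?exprn_ge0 ?invr_ge0 ?ler0n ?nsq_ge0.
Qed.

Lemma Re_avg n (f : n.-tuple site -> C) : Re (avg f) = avg (fun t => Re (f t)).
Proof.
rewrite /avg -Re_sum -Re_rM; congr (Re (_ * _)).
by rewrite rmorphXn /= fmorphV /= rmorph_nat.
Qed.

Lemma svec_isotropic n (y : 'cV[C]_n) :
  avg (fun t : n.-tuple site => nsq (dot (svec R t) y)) = vnsq y.
Proof.
have := congr1 Re (svec_moment2 y y); rewrite dotxx Re_avg /= => <-.
by apply: eq_avg => t; rewrite -[dot y _]dot_conj -nsqE.
Qed.

Lemma dot_bas (j : 'I_d) (v : 'cV[C]_d) : dot (bas j) v = v j 0.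
Proof.
rewrite /dot (bigD1 j) //= big1 => [|i ij]; rewrite !mxE ?eqxx /=.
  by rewrite conjc1 mul1r addr0.
by rewrite (negbTE ij) conjc0 mul0r.
Qed.

Lemma vnsq_bas j : vnsq (bas j) = 1.
Proof. by apply: complexI; rewrite -dotxx dot_bas mxE !eqxx. Qed.

Lemma nsq_ph t : nsq (ph R t) = 1.
Proof.
have n1 : nsq (1 : C) = 1 by rewrite /nsq /= expr0n expr1n addr0.
have ni : nsq (Complex 0 1 : C) = 1 by rewrite /nsq /= expr0n expr1n add0r.
case: t => [[] []]; rewrite /ph nsqM /= ?nsqN ?n1 ?ni; exact: mulr1.
Qed.

Lemma sum_nsq_ph (a b : C) : \sum_t nsq (a + ph R t * b) = 4 * (nsq a + nsq b).
Proof.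
rewrite sum_ph /ph /= !(mul1r, mulN1r, mulNr) !nsqD !mulrN !nsqN !ReN.
have -> : nsq (Complex 0 1 * b) = nsq b.
  by rewrite nsqM /nsq /= expr0n expr1n add0r mul1r.
by ring.
Qed.

Lemma sum_vnsq_inp j : \sum_t vnsq (inp (j, t)) = 8.
Proof.
rewrite /vnsq exchange_big /=.
under eq_bigr => i _.
  under eq_bigr => t _ do rewrite /inp [fst _]/= [snd _]/= mxE [X in _ + X]mxE.
  rewrite sum_nsq_ph mulrDr; over.
rewrite big_split /= -!big_distrr /= -!/(vnsq _) !vnsq_bas; ring.
Qed.

Lemma pZ_sum Z : unitary Z -> \sum_w pZ Z w = 1.
Proof.
move=> hZ; rewrite /pZ (sum_outcome (fun i t => nsq (dot (svec R t) (Z *m inp i)))).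
under eq_bigr do rewrite svec_isotropic vnsq_unitary //.
rewrite sum_input; under eq_bigr do rewrite sum_vnsq_inp.
rewrite sumr_const card_ord -[8 *+ d]mulr_natr mulVf //.
by rewrite mulf_neq0 ?pnatr_eq0.
Qed.

(** A Fourier coefficient in the phase: the fourth roots of unity and their squares both sum to 0,
    so only the term proportional to the phase survives. *)
Lemma sum_ph_polar (a b : C) :
  \sum_t (nsq (a + ph R t * b))%:C * conjc (ph R t) = 4 * (conjc a * b).
Proof.
under eq_bigr do rewrite nsqE rmorphD rmorphM /= conjc_ph.
rewrite sum_ph /ph /cph /=; have := sqr_iC R.
move: (Complex 0 1) (conjc a) (conjc b) => i a' b' i2.
by ring: i2.
Qed.

Lemma mulmx_bas (Z : 'M[C]_d) (s v : 'cV[C]_d) :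
  \sum_j v j 0 * dot s (Z *m bas j) = dot s (Z *m v).
Proof.
have -> : v = \sum_j v j 0 *: bas j.
  apply/colP => i; rewrite summxE (bigD1 i) //= big1 => [|j ij];
    rewrite !mxE ?eqxx ?mulr1 ?addr0 //.
  by rewrite eq_sym (negbTE ij) mulr0.
rewrite mulmx_sumr [RHS](big_morph (dot s) (dotDr s) (_ : _ = 0)).
  apply: eq_bigr => j _; rewrite -scalemxAr dotZr; congr (_ * _).
  rewrite summxE (bigD1 j) //= big1 => [|i ij];
    rewrite !mxE ?eqxx ?mulr1 ?addr0 //.
  by rewrite eq_sym (negbTE ij) mulr0.
by rewrite /dot big1 // => i _; rewrite mxE mulr0.
Qed.

(** For fixed s the phase sum leaves <Z e_0, s> <s, Z e_j>, and the weights v_j assemble <s, Z v>.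
    Wick's formula then applies, and unitarity turns <Z e_0, Z v> into v_0. *)
Lemma stat_mean Z u w v : unitary Z ->
  \sum_o pZ Z o * stat u w v o = mean Z u w v.
Proof.
move=> hZ.
pose f (i : input) (t : d.-tuple site) : R :=
  Re (2 * d%:R * (v i.1 0 * ((nsq (dot (svec R t) (Z *m inp i)))%:C
    * conjc (ph R i.2))) * (dot w (svec R t) * dot (svec R t) u)).
under eq_bigr => o _.
  rewrite /pZ /stat -!mulrA -Re_rM.
  rewrite (_ : Re _ = f o.1 o.2); last first.
    congr Re; rewrite rmorphM /= !rmorph_nat; ring.
  over.
rewrite (sum_outcome f) -avg_sum.
rewrite (@eq_avg _ _ _ (fun t => 8 * d%:R * Re ((dot (Z *m bas 0) (svec R t) *
   dot (svec R t) (Z *m v)) * (dot w (svec R t) * dot (svec R t) u)))); last first.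
  move=> t; rewrite -Re_sum -Re_rM; congr Re.
  rewrite sum_input rmorphM /= !rmorph_nat.
  under eq_bigr => j _.
    rewrite -big_distrl -big_distrr -big_distrr /=.
    under eq_bigr do rewrite /inp mulmxDr -scalemxAr dotDr dotZr /=.
    rewrite sum_ph_polar (_ : _ * _ =
      8 * d%:R * conjc (dot (svec R t) (Z *m bas 0)) *
       (dot w (svec R t) * dot (svec R t) u) *
       (v j 0 * dot (svec R t) (Z *m bas j))); last by ring.
    over.
  by rewrite -big_distrr /= mulmx_bas dot_conj; ring.
rewrite avgZ mulrA mulVf ?mul1r; last by rewrite mulf_neq0 ?pnatr_eq0.
by rewrite -Re_avg svec_moment4 dot_unitary // dot_bas.
Qed.

End RoundDistribution.

(** * The exponentially tilted second moment of the statistic *)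

Section MomentBound.
Variables (R : realType) (k : nat).
Local Notation d := k.+1.
Local Notation C := (complex R).
Local Notation Re := (@complex.Re R).
Local Notation "x %:C" := (real_complex R x).

(** Each factor x is traded for K exp (x / K), and [expR_sum3_le] then separates g, a and b. After
    averaging, only exponential moments of single inner products remain. *)
Lemma moment_pointwise (K g a b : R) : 0 < K -> 0 <= g -> 0 <= a -> 0 <= b ->
  g * (a * b * expR (K^-1 * (a + b))) <=
  K ^+ 3 * (expR (3 * K^-1 * g) + expR (6 * K^-1 * a) + expR (6 * K^-1 * b)).
Proof.
move=> K0 g0 a0 b0; have k0 : 0 < K^-1 by rewrite invr_gt0.
have h x : x <= K * expR (K^-1 * x).
  by have := le_expR_div x k0; rewrite invrK mulrC.
apply: (@le_trans _ _ (K * expR (K^-1 * g) * ((K * expR (K^-1 * a)) *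
    (K * expR (K^-1 * b)) * expR (K^-1 * (a + b))))).
  apply: ler_pM => //; first by rewrite !mulr_ge0 ?expR_ge0.
  by rewrite ler_wpM2r ?expR_ge0 // ler_pM.
have -> : K * expR (K^-1 * g) * ((K * expR (K^-1 * a)) *
    (K * expR (K^-1 * b)) * expR (K^-1 * (a + b))) =
    K ^+ 3 * expR (K^-1 * g + 2 * K^-1 * a + 2 * K^-1 * b).
  have -> : K^-1 * g + 2 * K^-1 * a + 2 * K^-1 * b =
    K^-1 * g + K^-1 * a + K^-1 * b + K^-1 * (a + b) by ring.
  by rewrite !expRD; ring.
rewrite ler_pM2l ?exprn_gt0 //; apply: le_trans (expR_sum3_le _ _ _) _.
by rewrite !mulrA -!natrM.
Qed.

Lemma stat_sqr_le u w v (o : outcome k) :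
  (stat u w v o : R) ^+ 2 <= 4 * d%:R ^+ 2 * nsq (v o.1.1 0) *
    (nsq (dot (svec R o.2) w) * nsq (dot (svec R o.2) u)).
Proof.
apply: le_trans (Re_sqr_le _) _; rewrite !nsqM nsq_real nsq_conj nsq_ph.
rewrite -[dot w _]dot_conj nsq_conj.
by rewrite le_eqVlt; apply/orP; left; apply/eqP; ring.
Qed.

Lemma stat_abs_le u w v (o : outcome k) : vnsq v <= 1 ->
  `|stat u w v o : R| <= d%:R *
    (nsq (dot (svec R o.2) w) + nsq (dot (svec R o.2) u)).
Proof.
move=> v1; have := stat_sqr_le u w v o.
set a := nsq (dot _ w); set b := nsq (dot _ u); set q := nsq _.
have a0 : 0 <= a by exact: nsq_ge0. have b0 : 0 <= b by exact: nsq_ge0.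
have q0 : 0 <= q by exact: nsq_ge0.
have q1 : q <= 1.
  apply: le_trans v1; rewrite /vnsq (bigD1 o.1.1) //= lerDl.
  by apply: sumr_ge0 => i _; exact: nsq_ge0.
have r0 : 0 <= d%:R * (a + b) by apply: mulr_ge0; [exact: ler0n|exact: addr_ge0].
move=> h; rewrite -(@ler_pXn2r _ 2) ?nnegrE //.
rewrite real_normK ?num_real //; apply: le_trans h _.
apply: (@le_trans _ _ (d%:R ^+ 2 * (4 * (a * b)))).
  have -> : 4 * d%:R ^+ 2 * q * (a * b) = q * (d%:R ^+ 2 * (4 * (a * b))) by ring.
  by rewrite ler_piMl // mulr_ge0 ?sqr_ge0 // !mulr_ge0.
rewrite exprMn; apply: ler_wpM2l; first exact: sqr_ge0.
have := sqr_ge0 (a - b); lra.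
Qed.

Lemma avg_lin n (c : R) (e0 e1 e2 e3 : n.-tuple site -> R) :
  avg (fun t => c * ((e0 t + (e2 t + e3 t)) + (e1 t + (e2 t + e3 t)))) =
  c * ((avg e0 + (avg e2 + avg e3)) + (avg e1 + (avg e2 + avg e3))).
Proof. by rewrite avgZ !avgD. Qed.

(** The statistic is of size d |v_j|, so its square averages over the random coordinate j to order
    d^2 |v|^2 / d. This gives a bound linear in d. *)
Lemma stat_moment Z u w v (lam : R) : unitary Z ->
  vnsq u <= 1 -> vnsq w <= 1 -> vnsq v <= 1 -> 0 <= lam ->
  lam * d%:R <= 256^-1 ->
  \sum_(o : outcome k) pZ Z o * (stat u w v o ^+ 2 * expR (lam * `|stat u w v o|))
  <= 48 * 256 ^+ 3 * d%:R.
Proof.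
move=> hZ u1 w1 v1 lam0 lamd; set K : R := 256.
(* The value 256 puts 6 / K below 1/32, within the range of [svec_subgaussian]. *)
have [K0 KE] : 0 < K /\ K = 256 by [].
rewrite -KE in lamd; clearbody K.
pose E (c : R) (y : 'cV[C]_d) (t : d.-tuple site) := expR (c * nsq (dot (svec R t) y)).
have avgE c y : 0 < c -> c <= 32^-1 -> vnsq y <= 1 -> avg (E c y) <= 2.
  by move=> c0 c1 y1; exact: svec_subgaussian.
pose W (t : d.-tuple site) := E (6 * K^-1) w t + E (6 * K^-1) u t.
pose f (i : input k) (t : d.-tuple site) :=
  8 * d%:R ^+ 2 * nsq (v i.1 0) * K ^+ 3 *
   ((E (3 * K^-1) (Z *m bas R 0) t + W t) + (E (3 * K^-1) (Z *m bas R i.1) t + W t)).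
apply: (@le_trans _ _ (\sum_(o : outcome k) (8 * d%:R)^-1 * (8^-1 ^+ d * f o.1 o.2))).
  apply: ler_sum => o _; rewrite /pZ -(mulrA (8 * d%:R)^-1).
  rewrite ler_pM2l ?invr_gt0 ?mulr_gt0 // -(mulrA (8^-1 ^+ d)) ler_pM2l ?exprn_gt0 ?invr_gt0 //.
  rewrite /inp mulmxDr -scalemxAr dotDr dotZr.
  set s := svec R o.2; set a := nsq (dot s w); set b := nsq (dot s u).
  have a0 : 0 <= a by exact: nsq_ge0. have b0 : 0 <= b by exact: nsq_ge0.
  set g0 := dot s (Z *m bas R 0); set g1 := dot s (Z *m bas R o.1.1).
  set q := nsq (v o.1.1 0); have q0 : 0 <= q by exact: nsq_ge0.
  have hg : nsq (g0 + ph R o.1.2 * g1) <= 2 * nsq g0 + 2 * nsq g1.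
    by apply: le_trans (nsqD_le _ _) _; rewrite nsqM nsq_ph mul1r.
  have he : expR (lam * `|stat u w v o|) <= expR (K^-1 * (a + b)).
    rewrite ler_expR.
    apply: le_trans (ler_wpM2l lam0 (stat_abs_le u w o v1)) _.
    by rewrite mulrA ler_wpM2r // addr_ge0.
  have hs : stat u w v o ^+ 2 * expR (lam * `|stat u w v o|) <=
     4 * d%:R ^+ 2 * q * (a * b * expR (K^-1 * (a + b))).
    rewrite (mulrA _ (a * b)); apply: ler_pM => //; rewrite ?sqr_ge0 ?expR_ge0 //.
    exact: stat_sqr_le.
  set e := a * b * expR _ in hs.
  have hm y : nsq (dot s y) * e <= K ^+ 3 * (E (3 * K^-1) y o.2 + W o.2).
    rewrite /W addrA; exact: (moment_pointwise K0 (nsq_ge0 _) a0 b0).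
  apply: (@le_trans _ _ ((2 * nsq g0 + 2 * nsq g1) * (4 * d%:R ^+ 2 * q * e))).
    apply: ler_pM => //; first exact: nsq_ge0.
    by apply: mulr_ge0; [exact: sqr_ge0|exact: expR_ge0].
  have -> : (2 * nsq g0 + 2 * nsq g1) * (4 * d%:R ^+ 2 * q * e) =
    8 * d%:R ^+ 2 * q * (nsq g0 * e + nsq g1 * e).
    by move: (nsq g0) (nsq g1) (e) (d%:R) (q) => *; ring.
  rewrite /f -[leRHS]mulrA; apply: ler_wpM2l.
    by apply: mulr_ge0 => //; apply: mulr_ge0 => //; exact: sqr_ge0.
  by rewrite [K ^+ 3 * _]mulrDr; apply: lerD; exact: hm.
rewrite (sum_outcome f) mulrC ler_pdivrMr ?mulr_gt0 //.
have K1 : 6 * K^-1 <= 32^-1 by rewrite KE; lra.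
have K2 : 3 * K^-1 <= 32^-1 by rewrite KE; lra.
have K3 : 0 < K^-1 by rewrite invr_gt0.
have hf i : avg (f i) <= 96 * d%:R ^+ 2 * K ^+ 3 * nsq (v i.1 0).
  rewrite (_ : avg (f i) = 8 * d%:R ^+ 2 * nsq (v i.1 0) * K ^+ 3 *
      ((avg (E (3 * K^-1) (Z *m bas R 0)) +
         (avg (E (6 * K^-1) w) + avg (E (6 * K^-1) u))) +
       (avg (E (3 * K^-1) (Z *m bas R i.1)) +
         (avg (E (6 * K^-1) w) + avg (E (6 * K^-1) u))))); last exact: avg_lin.
  have p3 : 0 < 3 * K^-1 by rewrite mulr_gt0.
  have p6 : 0 < 6 * K^-1 by rewrite mulr_gt0.
  have hb j : vnsq (Z *m bas R j) <= 1 by rewrite vnsq_unitary // vnsq_bas.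
  have -> : 96 * d%:R ^+ 2 * K ^+ 3 * nsq (v i.1 0) =
     8 * d%:R ^+ 2 * nsq (v i.1 0) * K ^+ 3 * 12 by ring.
  apply: ler_wpM2l.
    apply: mulr_ge0; last by rewrite exprn_ge0 // ltW.
    by apply: mulr_ge0; [apply: mulr_ge0 => //; exact: sqr_ge0|exact: nsq_ge0].
  have W4 : avg (E (6 * K^-1) w) + avg (E (6 * K^-1) u) <= 2 + 2.
    by apply: lerD; [exact: (avgE _ w p6 K1 w1)|exact: (avgE _ u p6 K1 u1)].
  have := lerD (lerD (avgE _ _ p3 K2 (hb 0)) W4) (lerD (avgE _ _ p3 K2 (hb i.1)) W4).
  by move/le_trans; apply; lra.
apply: (@le_trans _ _ (\sum_(i : input k) 96 * d%:R ^+ 2 * K ^+ 3 * nsq (v i.1 0))).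
  by apply: ler_sum => i _; exact: hf.
rewrite -big_distrr sum_input /=.
under eq_bigr do rewrite sumr_const card_prod card_bool -mulr_natr.
rewrite -big_distrl /= -/(vnsq v).
have -> : 48 * K ^+ 3 * d%:R * (8 * d%:R) = 96 * d%:R ^+ 2 * K ^+ 3 * (1 * (2 * 2)%:R).
  by ring.
apply: ler_wpM2l; first by rewrite !mulr_ge0 ?sqr_ge0 ?exprn_ge0 // ltW.
by rewrite ler_wpM2r.
Qed.

End MomentBound.

(** * Nets and the operator norm *)

Section Net.
Variable R : realType.
Local Notation C := (complex R).
Local Notation Re := (@complex.Re R).
Local Notation Im := (@complex.Im R).

Lemma bin_le_exp2 n m : ('C(n, m) <= 2 ^ n)%N.
Proof.
elim: n m => [|n IH] [|m]; rewrite ?bin0 ?expn_gt0 // binS expnS mul2n -addnn.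
by rewrite leq_add.
Qed.

Definition rsign (b : bool) : R := if b then -1 else 1.

(** Rounding toward zero keeps the rounded point inside the ball. The first bound uses m <= m^2 for
    naturals and serves to count the grid points. *)
Lemma round_toward_zero (r a : R) : 0 < r ->
  let m := Num.truncn (r * `|a|) in let y := rsign (a < 0) * m%:R / r in
  [/\ m%:R <= r ^+ 2 * a ^+ 2, y ^+ 2 <= a ^+ 2 & (a - y) ^+ 2 <= (r ^+ 2)^-1].
Proof.
move=> r0 m y; have ra0 : 0 <= r * `|a| by rewrite mulr_ge0 // ltW.
have /andP[hm1 hm2] : m%:R <= r * `|a| < m.+1%:R by exact: Num.Theory.truncn_itv.
have m0 : 0 <= m%:R :> R by rewrite ler0n.
have m2 : m%:R ^+ 2 <= r ^+ 2 * a ^+ 2.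
  rewrite -(real_normK (num_real a)) -exprMn.
  by rewrite ler_pXn2r ?nnegrE.
have s2 b : rsign b ^+ 2 = 1 by case: b; rewrite /rsign ?sqrrN expr1n.
split.
- apply: le_trans m2; rewrite -natrX ler_nat.
  by case: (m) => // n; rewrite -[leqLHS]muln1 leq_mul.
- by rewrite !exprMn s2 mul1r exprVn ler_pdivrMr ?exprn_gt0 // mulrC.
have aE : a = rsign (a < 0) * `|a|.
  rewrite /rsign; case: ltP => h; first by rewrite ltr0_norm // mulN1r opprK.
  by rewrite ger0_norm // mul1r.
have -> : a - y = rsign (a < 0) * ((r * `|a| - m%:R) / r).
  by rewrite {1}aE /y; field; rewrite gt_eqF.
rewrite !exprMn s2 mul1r exprVn -[leRHS]mul1r ler_wpM2r ?invr_ge0 ?sqr_ge0 //.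
rewrite expr_le1 ?subr_ge0 // lerBlDr ltW //.
by rewrite -natr1 addrC in hm2.
Qed.

(** The grid has mesh 1 / r with r^2 = 16 n in 2 n real coordinates. The absolute numerators have
    sum at most 16 n, so there are at most 2^(18 n) choices of them and 2^(2 n) choices of signs.
    The squared error is at most 2 n / (16 n) = 1/8. *)
Lemma unit_net n : (0 < n)%N -> exists net : seq 'cV[C]_n,
  [/\ (size net <= 2 ^ (20 * n))%N, forall x, x \in net -> vnsq x <= 1 &
  forall x, vnsq x = 1 -> exists2 y, y \in net & vnsq (x - y) <= 4^-1].
Proof.
move=> n0; pose r : R := Num.sqrt (16 * n%:R); pose m := (16 * n)%N.
have r2 : r ^+ 2 = 16 * n%:R by rewrite sqr_sqrtr // mulr_ge0.
have r0 : 0 < r by rewrite sqrtr_gt0 mulr_gt0 // ltr0n.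
pose I := ((n + n).-tuple 'I_m.+1 * (n + n).-tuple bool)%type.
pose c (p : I) i := rsign (tnth p.2 i) * (tnth p.1 i)%:R / r.
pose pt (p : I) : 'cV[C]_n := \col_i Complex (c p (lshift n i)) (c p (rshift n i)).
pose A := [set t : (n + n).-tuple 'I_m.+1 | (\sum_(i <- t) i <= m)%N].
(* The bound on the numerators alone allows points outside the unit ball; the filter removes
   them. *)
exists [seq x <- [seq pt p | p <- enum (finset.setX A [set: (n + n).-tuple bool])] | vnsq x <= 1].
split.
- rewrite size_filter; apply: leq_trans (count_size _ _) _.
  rewrite size_map -cardE cardsX cardsT card_tuple card_bool.
  rewrite card_partial_ord_partitions.
  apply: (@leq_trans (2 ^ (n + n + m) * 2 ^ (n + n))).
    by rewrite leq_mul2r bin_le_exp2 orbT.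
  by rewrite -expnD leq_exp2l // /m; lia.
- by move=> x; rewrite mem_filter => /andP[].
move=> x x1.
pose a (i : 'I_(n + n)) := match split i with inl j => Re (x j 0) | inr j => Im (x j 0) end.
have al j : a (lshift n j) = Re (x j 0) by rewrite /a (unsplitK (inl j)).
have ar j : a (rshift n j) = Im (x j 0) by rewrite /a (unsplitK (inr j)).
have a2 : \sum_i a i ^+ 2 = 1.
  rewrite big_split_ord /= -x1 /vnsq -big_split; apply: eq_bigr => j _ /=.
  by rewrite al ar.
pose q i := Num.truncn (r * `|a i|).
have qsum : (\sum_i q i <= m)%N.
  rewrite -(ler_nat R) natr_sum /m natrM -r2 -[leRHS]mulr1 -[X in _ <= _ * X]a2 big_distrr /=.
  by apply: ler_sum => i _; have [h _ _] := round_toward_zero (a i) r0; exact: h.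
have qm i : (q i < m.+1)%N.
  by rewrite ltnS; apply: leq_trans qsum; rewrite (bigD1 i) //= leq_addr.
pose t := [tuple Ordinal (qm i) | i < n + n].
pose s := [tuple a i < 0 | i < n + n].
have cE i : c (t, s) i = rsign (a i < 0) * (q i)%:R / r.
  by rewrite /c /= !tnth_mktuple.
exists (pt (t, s)).
  rewrite mem_filter map_f ?andbT; last first.
    rewrite mem_enum inE /= !inE andbT big_tuple.
    by under eq_bigr do rewrite tnth_mktuple.
  rewrite -x1; apply: ler_sum => j _; rewrite mxE /nsq /= !cE -al -ar.
  by apply: lerD; [case: (round_toward_zero (a (lshift n j)) r0)
                  |case: (round_toward_zero (a (rshift n j)) r0)].
apply: (@le_trans _ _ (\sum_(j < n) ((r ^+ 2)^-1 + (r ^+ 2)^-1))).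
  apply: ler_sum => j _; rewrite !mxE.
  have -> : nsq (x j 0 - Complex (c (t, s) (lshift n j)) (c (t, s) (rshift n j))) =
     (a (lshift n j) - c (t, s) (lshift n j)) ^+ 2 +
     (a (rshift n j) - c (t, s) (rshift n j)) ^+ 2.
    by rewrite al ar; case: (x j 0).
  rewrite !cE.
  by apply: lerD; [case: (round_toward_zero (a (lshift n j)) r0)
                  |case: (round_toward_zero (a (rshift n j)) r0)].
rewrite sumr_const card_ord -[_ *+ n]mulr_natr r2.
have n0' : 0 < n%:R :> R by rewrite ltr0n.
have -> : ((16 * n%:R)^-1 + (16 * n%:R)^-1) * n%:R = 8^-1 :> R.
  by field; rewrite gt_eqF.
lra.
Qed.

End Net.

(** * The operator norm and the distance up to phase *)

Section Geometry.
Variables (R : realType) (d : nat).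
Hypothesis d_gt0 : (0 < d)%N.
Local Notation C := (complex R).
Local Notation Re := (@complex.Re R).
Local Notation "x %:C" := (real_complex R x).
Implicit Types (A M Z V : 'M[C]_d) (x y v w : 'cV[C]_d).

Lemma unit_vector : exists v, vnorm v = 1.
Proof.
exists (delta_mx (Ordinal d_gt0) 0); apply/vnorm1.
rewrite /vnsq (bigD1 (Ordinal d_gt0)) //= big1 => [|i ij]; rewrite mxE ?eqxx.
  by rewrite /nsq /= expr0n expr1n !addr0.
by rewrite (negbTE ij) /nsq /= expr0n addr0.
Qed.

Lemma opnorm_ge0 A : 0 <= opnorm A.
Proof.
rewrite /opnorm; set S := (X in sup X).
(* Where no supremum exists, [sup] takes the value 0. *)
have [h|h] := pselect (has_sup S); last by rewrite sup_out.
have [v v1] := unit_vector.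
apply: le_trans (vnorm_ge0 (A *m v)) _.
by apply: ub_le_sup; [case: h|exists v].
Qed.

Lemma opnorm_le A b : (forall v, vnorm v = 1 -> vnorm (A *m v) <= b) -> opnorm A <= b.
Proof.
move=> h; apply: ge_sup; last by move=> _ [v /= v1 <-]; exact: h.
by have [v v1] := unit_vector; exists (vnorm (A *m v)); exists v.
Qed.

Lemma opnorm_ge A b v : (forall v, vnorm v = 1 -> vnorm (A *m v) <= b) ->
  vnorm v = 1 -> vnorm (A *m v) <= opnorm A.
Proof.
move=> h v1; apply: ub_le_sup; last by exists v.
by exists b => _ [u /= u1 <-]; exact: h.
Qed.

Lemma pudist_le Z V (phi : C) b : cabs phi = 1 ->
  opnorm (phi *: Z - V) <= b -> pudist Z V <= b.
Proof.
move=> p1; apply: le_trans; apply: ge_inf; last by exists phi.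
by exists 0 => _ [psi _ <-]; exact: opnorm_ge0.
Qed.

Lemma cabs_polar (z : C) : exists2 phi : C, cabs phi = 1 & z = (cabs z)%:C * phi.
Proof.
have [z0|z0] := eqVneq (cabs z) 0.
  exists 1; first by rewrite -[1]/(1%:C) cabs_real normr1.
  rewrite z0 mul0r; have := cabs_sqr z; rewrite z0 expr0n /= => /esym.
  move=> /eqP; rewrite paddr_eq0 ?sqr_ge0 // !sqrf_eq0.
  by case: z {z0} => a b /= /andP[/eqP -> /eqP ->].
exists ((cabs z)^-1%:C * z).
  by rewrite cabsM cabs_real ger0_norm ?invr_ge0 ?cabs_ge0 // mulVf.
by rewrite mulrA -rmorphM /= divff // mul1r.
Qed.

(** With S the norm of M, replacing w by a net point costs |M v| / 2 and replacing v costs S / 2.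
    Hence S <= 2 b + S / 2. The crude bound [B] makes S a genuine supremum. *)
Lemma net_opnorm_le M (net : seq 'cV[C]_d) (b B : R) :
  (forall x, vnsq x = 1 -> exists2 y, y \in net & vnsq (x - y) <= 4^-1) ->
  (forall v, vnorm v = 1 -> vnorm (M *m v) <= B) -> 0 <= b ->
  (forall w v, w \in net -> v \in net -> Re (dot w (M *m v)) <= b) ->
  forall v, vnorm v = 1 -> vnorm (M *m v) <= 4 * b.
Proof.
move=> hnet hB b0 hb.
have half x : vnsq x <= 4^-1 -> vnorm x <= 2^-1.
  move=> hx; rewrite -(@ler_pXn2r _ 2) ?nnegrE ?vnorm_ge0 ?invr_ge0 //.
  by rewrite vnorm_sqr; apply: le_trans hx _; rewrite expr2; lra.
pose S := opnorm M.
have hS x : vnorm (M *m x) <= S * vnorm x.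
  have [y xE y1] := vnorm_normalize x.
  have [x0|x0] := eqVneq (vnorm x) 0.
    rewrite x0 mulr0 xE x0 scale0r mulmx0 vnormE /vnsq big1 ?sqrtr0 // => i _.
    by rewrite mxE /nsq /= expr0n addr0.
  rewrite {1}xE -scalemxAr vnormZ cabs_real ger0_norm ?vnorm_ge0 // mulrC.
  by apply: ler_wpM2r; [exact: vnorm_ge0|apply: opnorm_ge hB (y1 x0)].
have step v : v \in net -> vnorm (M *m v) <= 2 * b.
  move=> vn; have [w wE w1] := vnorm_normalize (M *m v).
  have [->|x0] := eqVneq (vnorm (M *m v)) 0; first by rewrite mulr_ge0.
  have {}w1 := w1 x0; set nv := vnorm (M *m v) in wE x0 *.
  have nv0 : 0 <= nv by exact: vnorm_ge0.
  have [w' w'n hw'] := hnet w (proj1 (vnorm1 w) w1).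
  have e1 : Re (dot w (M *m v)) = nv.
    by rewrite wE dotZr dotxx (proj1 (vnorm1 w) w1) Re_rM mulr1.
  have e2 : Re (dot (w - w') (M *m v)) <= 2^-1 * nv.
    apply: le_trans (ler_norm _) _; apply: le_trans (Re_dot_le _ _) _.
    by apply: ler_wpM2r => //; exact: half.
  have e3 := hb _ _ w'n vn.
  rewrite dotDl dotNl ReB e1 in e2; lra.
have SS : S <= 2 * b + S * 2^-1.
  apply: opnorm_le => v v1; have [v' v'n hv'] := hnet v (proj1 (vnorm1 v) v1).
  have -> : v = v' + (v - v') by rewrite addrC subrK.
  rewrite mulmxDr; apply: le_trans (vnormD _ _) _; apply: lerD; first exact: step.
  apply: le_trans (hS _) _; apply: ler_wpM2l; first exact: opnorm_ge0.
  exact: half.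
move=> v v1; apply: le_trans (opnorm_ge hB v1) _; rewrite -/S; lra.
Qed.

Lemma vnorm_lincomb_le Z V (a b : C) v : unitary Z -> unitary V -> vnorm v = 1 ->
  vnorm ((a *: Z - b *: V) *m v) <= cabs a + cabs b.
Proof.
move=> hZ hV v1; rewrite mulmxBl -!scalemxAl; apply: le_trans (vnormB _ _) _.
by rewrite !vnormZ !vnorm_unitary // v1 !mulr1.
Qed.

Lemma pudist_le2 Z V : unitary Z -> unitary V -> pudist Z V <= 2.
Proof.
move=> hZ hV; have c1 : cabs (1 : C) = 1 by rewrite -[1]/(1%:C) cabs_real normr1.
apply: (pudist_le c1); apply: opnorm_le => v v1.
have := vnorm_lincomb_le 1 1 hZ hV v1.
by rewrite c1 scale1r [X in _ - X]scale1r.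
Qed.

(* The optimal phase is replaced by that of a / g, and |a / g| is close to 1
   because Z and V are isometries. *)
Lemma pudist_of_lincomb Z V (a g : C) (b : R) : unitary Z -> unitary V ->
  2^-1 <= cabs g ->
  (forall v, vnorm v = 1 -> vnorm ((a *: Z - g *: V) *m v) <= b) ->
  pudist Z V <= 4 * b.
Proof.
move=> hZ hV g2 h; have g0 : g != 0.
  by apply: contraTneq g2 => ->; rewrite -[0]/(0%:C) cabs_real normr0 -ltNge invr_gt0.
have h1 v : vnorm v = 1 -> vnorm (((a / g) *: Z - V) *m v) <= 2 * b.
  move=> v1; have := h v v1.
  have -> : a *: Z - g *: V = g *: ((a / g) *: Z - V).
    by rewrite scalerBr scalerA mulrCA divff // mulr1.
  rewrite -scalemxAl vnormZ.
  have := vnorm_ge0 (((a / g) *: Z - V) *m v); move: (vnorm _) => x x0.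
  move=> hx; have := ler_wpM2r x0 g2; lra.
have [phi p1 aE] := cabs_polar (a / g).
have rb : `|1 - cabs (a / g)| <= 2 * b.
  have [v v1] := unit_vector; have hv := h1 v v1.
  have nZ : vnorm ((a / g) *: (Z *m v)) = cabs (a / g).
    by rewrite vnormZ vnorm_unitary // v1 mulr1.
  have nV : vnorm (V *m v) = 1 by rewrite vnorm_unitary.
  rewrite mulmxBl -scalemxAl in hv.
  have t1 := vnormD ((a / g) *: (Z *m v) - V *m v) (V *m v).
  have t2 := vnormB ((a / g) *: (Z *m v)) ((a / g) *: (Z *m v) - V *m v).
  rewrite subrK nZ nV in t1; rewrite opprB addrCA subrr addr0 nZ nV in t2.
  rewrite ler_norml; apply/andP; split; lra.
apply: (pudist_le p1); apply: opnorm_le => v v1.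
(* Correcting the modulus of a / g costs 2 b, on top of the error 2 b of (a / g) Z - V. *)
have -> : phi *: Z - V = ((1 - cabs (a / g))%:C * phi) *: Z + ((a / g) *: Z - V).
  by rewrite addrA -scalerDl [X in _ * phi + X]aE -mulrDl -rmorphD /= subrK mul1r.
rewrite mulmxDl; apply: le_trans (vnormD _ _) _.
rewrite -scalemxAl vnormZ cabsM p1 cabs_real vnorm_unitary // v1 !mulr1.
have := h1 v v1; lra.
Qed.

End Geometry.

(** * The query algorithm *)

Section Algorithm.
Variables (R : realType) (k : nat).
Local Notation d := k.+1.
Local Notation C := (complex R).
Local Notation Re := (@complex.Re R).
Local Notation "x %:C" := (real_complex R x).

Lemma adjZ m n a (A : 'M[C]_(m, n)) : adj (a *: A) = conjc a *: adj A.
Proof. by apply/matrixP => i j; rewrite !mxE rmorphM. Qed.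

Lemma adjK m n (A : 'M[C]_(m, n)) : adj (adj A) = A.
Proof. by apply/matrixP => i j; rewrite !mxE conjcK. Qed.

Lemma adj_mul_vec n (x : 'cV[C]_n) : adj x *m x = (vnsq x)%:C%:M.
Proof. by apply/matrixP => i j; rewrite !ord1 -dotE dotxx mxE eqxx. Qed.

Definition rank1 (c : R) (x y : 'cV[C]_d) : 'M[C]_d := c%:C *: (x *m adj y).

Lemma adj_rank1 c x y : adj (rank1 c x y) = rank1 c y x.
Proof. by rewrite adjZ adjM adjK conjc_real. Qed.

Lemma rank1_gram c x y :
  adj (rank1 c x y) *m rank1 c x y = (c ^+ 2 * vnsq x)%:C *: (y *m adj y).
Proof.
rewrite adj_rank1 -scalemxAl -scalemxAr scalerA mulmxA -(mulmxA y) adj_mul_vec.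
by rewrite mul_mx_scalar -scalemxAl scalerA -!rmorphM -expr2.
Qed.

Lemma rank1_apply c x y (rho : 'M[C]_d) :
  rank1 c x y *m rho *m adj (rank1 c x y) =
  ((c ^+ 2)%:C * dot y (rho *m y)) *: (x *m adj x).
Proof.
rewrite adj_rank1 -!scalemxAl -scalemxAr scalerA -rmorphM -expr2 -scalerA.
congr (_ *: _); rewrite !mulmxA -(mulmxA x) -(mulmxA x).
by rewrite [_ *m y]mx11_scalar -mulmxA -dotE mul_mx_scalar -scalemxAl.
Qed.

(** Measure and prepare: the sum over b traces out the old state, and outcome i leaves a multiple of
    the projector on [inp R i]. The outcome itself supplies the random choice of input. *)
Definition prepK (i : input k) : seq 'M[C]_d :=
  [seq rank1 (Num.sqrt (8 * d%:R)^-1) (inp R i) (bas R b) | b <- index_enum 'I_d].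

(** The single Kraus operator of the POVM element 8^-d s s^*, resetting the register to e_0. *)
Definition measK (s : d.-tuple site) : seq 'M[C]_d :=
  [:: rank1 (Num.sqrt (8^-1 ^+ d)) (bas R 0) (svec R s)].

Definition round (next : outcome k -> alg R d) : alg R d :=
  Instr (fun i : 'I_#|input k| => prepK (enum_val i)) (fun i =>
  Query (Instr (fun j : 'I_#|{: d.-tuple site}| => measK (enum_val j)) (fun j =>
  next (enum_val i, enum_val j)))).

Fixpoint rounds n (V : seq (outcome k) -> 'M[C]_d) : alg R d :=
  if n is n'.+1 then round (fun o => rounds n' (fun l => V (o :: l)))
  else Output (V [::]).

Lemma sum_enum_val (V : nmodType) (T : finType) (F : T -> V) :
  \sum_(i < #|T|) F (enum_val i) = \sum_x F x.
Proof. by rewrite (reindex (@enum_val T T)) //; apply: onW_bij; exact: enum_val_bij. Qed.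

Lemma sum_bas_proj : \sum_j bas R j *m adj (bas R j) = 1%:M :> 'M[C]_d.
Proof.
apply/matrixP => a b; rewrite summxE (bigD1 b) //= big1 => [|j jb]; rewrite !mxE big_ord1 !mxE.
  by rewrite !eqxx conjc1 mulr1 andbT addr0.
by rewrite eqxx andbT [b == j]eq_sym (negbTE jb) conjc0 mulr0.
Qed.

Lemma prepK_complete :
  \sum_(i < #|input k|) \sum_(K <- prepK (enum_val i)) adj K *m K = 1%:M.
Proof.
rewrite (sum_enum_val (fun i => \sum_(K <- prepK i) adj K *m K)).
under eq_bigr => i _.
  rewrite big_map; under eq_bigr do rewrite rank1_gram.
  rewrite -scaler_sumr sum_bas_proj; over.
rewrite -scaler_suml -rmorph_sum -big_distrr sum_input /=.
under eq_bigr do rewrite sum_vnsq_inp.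
rewrite sumr_const card_ord -[8 *+ d]mulr_natr sqr_sqrtr ?invr_ge0 ?mulr_ge0 ?ler0n //.
by rewrite mulVf ?scale1r // mulf_neq0 ?pnatr_eq0.
Qed.

(** This is the isotropy identity [svec_moment2] read entry by entry. *)
Lemma measK_complete :
  \sum_(i < #|{: d.-tuple site}|) \sum_(K <- measK (enum_val i)) adj K *m K = 1%:M.
Proof.
rewrite (sum_enum_val (fun i => \sum_(K <- measK i) adj K *m K)).
under eq_bigr => i _.
  rewrite big_seq1 rank1_gram vnsq_bas mulr1 sqr_sqrtr ?exprn_ge0 ?invr_ge0 //.
  over.
rewrite -scaler_sumr; apply/matrixP => a b.
have := svec_moment2 (bas R a) (bas R b).
rewrite /avg dot_bas mxE eqxx andbT => E; rewrite [RHS]mxE -E.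
rewrite mxE rmorphXn /= fmorphV /= rmorph_nat; congr (_ * _).
rewrite summxE; apply: eq_bigr => t _; rewrite mxE big_ord1 dot_bas.
by rewrite -[dot (svec _ _) _]dot_conj dot_bas !mxE.
Qed.

Lemma wf_rounds n V : (forall l, unitary (V l)) -> wf_alg (rounds n V).
Proof.
elim: n V => [|n IH] V hV /=; first exact: hV.
split; first exact: prepK_complete.
move=> i; split; first exact: measK_complete.
by move=> j; apply: IH => l.
Qed.

Lemma queries_rounds n V : (queries (rounds n V) <= n)%N.
Proof.
elim: n V => [//|n IH] V /=; apply/bigmax_leqP => i _.
by rewrite ltnS; apply/bigmax_leqP => j _.
Qed.

Lemma mxtrace_rank1 (x : 'cV[C]_d) : \tr (x *m adj x) = (vnsq x)%:C.
Proof. by rewrite mxtrace_mulC adj_mul_vec mxtrace_scalar. Qed.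

Lemma prepK_state i (rho : 'M[C]_d) :
  \sum_(K <- prepK i) K *m rho *m adj K =
  ((8 * d%:R)^-1%:C * \tr rho) *: (inp R i *m adj (inp R i)).
Proof.
rewrite big_map; under eq_bigr do rewrite rank1_apply.
rewrite -scaler_suml -big_distrr /=; congr ((_ * _) *: _).
  by rewrite sqr_sqrtr ?invr_ge0 ?mulr_ge0 ?ler0n.
apply: eq_bigr => b _; rewrite dot_bas mxE (bigD1 b) //= big1 => [|c cb].
  by rewrite mxE !eqxx mulr1 addr0.
by rewrite mxE (negbTE cb) mulr0.
Qed.

(** The preparation forgets everything about [rho] but its trace, so each round multiplies the
    weight by the same law [pZ Z] and the rounds are independent. *)
Lemma trace_round (Z rho : 'M[C]_d) (o : outcome k) :
  Re (\tr (\sum_(K <- measK o.2) K *m (Z *m (\sum_(K' <- prepK o.1)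
     K' *m rho *m adj K') *m adj Z) *m adj K)) = Re (\tr rho) * pZ Z o.
Proof.
rewrite big_seq1 rank1_apply prepK_state mxtraceZ mxtrace_rank1 vnsq_bas mulr1.
rewrite -scalemxAr -scalemxAl -scalemxAl dotZr.
set s := svec R o.2; set x := inp R o.1.
have -> : dot s (Z *m (x *m adj x) *m adj Z *m s) = (nsq (dot s (Z *m x)))%:C.
  rewrite nsqE dot_conj mulrC !dotE.
  rewrite (_ : adj s *m _ = (adj s *m (Z *m x)) *m (adj (Z *m x) *m s)).
    by rewrite mxE big_ord1.
  by rewrite adjM !mulmxA.
rewrite sqr_sqrtr ?exprn_ge0 ?invr_ge0 // /pZ.
rewrite (_ : _ * _ = ((8 * d%:R)^-1 * (8^-1 ^+ d * nsq (dot s (Z *m x))))%:C * \tr rho).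
  by rewrite Re_rM mulrC.
by rewrite !rmorphM /=; ring.
Qed.

Lemma prob_rounds Z P n V (rho : 'M[C]_d) :
  prob_from Z P (rounds n V) rho =
  Re (\tr rho) * iidE (pZ Z) n (fun l => if asbool (P (V l)) then 1 else 0).
Proof.
elim: n V rho => [|n IH] V rho /=; first by case: asbool; rewrite ?mulr1 ?mulr0.
under eq_bigr => i _ do under eq_bigr => j _ do
  rewrite IH (trace_round Z rho (enum_val i, enum_val j)).
rewrite (sum_enum_val (fun i : input k => \sum_(j < #|{: d.-tuple site}|)
  Re (\tr rho) * pZ Z (i, enum_val j) * iidE (pZ Z) n
   (fun l => if `[< P (V ((i, enum_val j) :: l)) >] then 1 else 0))).
transitivity (\sum_(i : input k) \sum_(j : d.-tuple site)
  Re (\tr rho) * pZ Z (i, j) * iidE (pZ Z) n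
   (fun l => if `[< P (V ((i, j) :: l)) >] then 1 else 0)).
  apply: eq_bigr => i _; exact: (sum_enum_val (fun j : d.-tuple site =>
   Re (\tr rho) * pZ Z (i, j) * iidE (pZ Z) n
   (fun l => if `[< P (V ((i, j) :: l)) >] then 1 else 0))).
rewrite pair_bigA big_distrr; apply: eq_bigr => -[i j] _ /=.
by rewrite mulrA.
Qed.

End Algorithm.

(** * The estimator *)

Section Estimator.
Variables (R : realType) (k : nat).
Local Notation d := k.+1.
Local Notation C := (complex R).
Local Notation Re := (@complex.Re R).
Variables (net : seq 'cV[C]_d) (tau : R) (N : nat).
Hypothesis net_le1 : forall x, x \in net -> vnsq x <= 1.
Hypothesis net_cover : forall x, vnsq x = 1 ->
  exists2 y, y \in net & vnsq (x - y) <= 4^-1.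
Hypotheses (tau_ge0 : 0 <= tau) (N_gt0 : (0 < N)%N).

Definition consistent (l : seq (outcome k)) (V : 'M[C]_d) : Prop :=
  forall u w v, u \in net -> w \in net -> v \in net ->
  `|\sum_(o <- l) stat u w v o - N%:R * mean V u w v| <= N%:R * tau.

(** The default value 1 keeps the output unitary even for data consistent with no unitary. *)
Definition estimate (l : seq (outcome k)) : 'M[C]_d :=
  xget 1%:M [set V | unitary V /\ consistent l V]%classic.

Lemma unitary1 : unitary (1%:M : 'M[C]_d).
Proof.
rewrite /unitary mulmx1; apply/matrixP => i j; rewrite !mxE eq_sym.
by case: eqP => _; rewrite ?conjc1 ?conjc0.
Qed.

Lemma unitary_estimate l : unitary (estimate l).
Proof. by rewrite /estimate; case: xgetP => [V _ []|_] //; exact: unitary1. Qed.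

Lemma estimate_consistent l Z : unitary Z -> consistent l Z ->
  consistent l (estimate l).
Proof.
move=> hZ cZ; have : [set V | unitary V /\ consistent l V]%classic Z by split.
by move/(xgetI 1%:M) => [].
Qed.

(** The term v_0 <w, u> does not depend on the matrix and cancels. *)
Lemma meanB (Z V : 'M[C]_d) (u w v : 'cV[C]_d) :
  mean Z u w v - mean V u w v =
  Re (dot w ((dot (Z *m bas R 0) u *: Z - dot (V *m bas R 0) u *: V) *m v)).
Proof.
rewrite /mean -ReB mulmxBl -!scalemxAl dotDr dotNr !dotZr; congr Re.
by rewrite opprD addrACA subrr add0r.
Qed.

Lemma consistent_pudist l Z V : unitary Z -> unitary V ->
  consistent l Z -> consistent l V -> pudist Z V <= 32 * tau.
Proof.
move=> hZ hV cZ cV; pose y := V *m bas R 0.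
have y1 : vnsq y = 1 by rewrite vnsq_unitary // vnsq_bas.
have [u un yu] := net_cover y1.
have g2 : 2^-1 <= cabs (dot y u).
  have yy : Re (dot y y) = 1 by rewrite dotxx y1.
  have h : Re (dot y (y - u)) <= 2^-1.
    apply: le_trans (ler_norm _) _; rewrite -(@ler_pXn2r _ 2) ?nnegrE ?invr_ge0 //.
    rewrite real_normK ?num_real //; apply: le_trans (Re_dot_sqr_le _ _) _.
    by rewrite y1 mul1r expr2; apply: le_trans yu _; lra.
  apply: le_trans (Re_le_cabs _); apply: le_trans (ler_norm _).
  rewrite dotDr dotNr ReB yy in h; lra.
have Np : 0 < N%:R :> R by rewrite ltr0n.
(* The two consistency bounds give 2 tau, the net a factor 4, and the passage to a unit phase
   another 4. *)
have -> : 32 * tau = 4 * (4 * (2 * tau)) by ring.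
apply: (pudist_of_lincomb (ltn0Sn k) (a := dot (Z *m bas R 0) u) hZ hV g2).
apply: (net_opnorm_le (ltn0Sn k) net_cover).
- by move=> v; exact: vnorm_lincomb_le.
- by rewrite mulr_ge0.
move=> w v wn vn; rewrite -meanB -(ler_pM2l Np).
have := cZ u w v un wn vn; have := cV u w v un wn vn.
rewrite !ler_norml => /andP[h1 h2] /andP[h3 h4]; lra.
Qed.

Lemma inconsistent_le l Z : size l = N ->
  ~ consistent l Z ->
  1 <= \sum_(u <- net) \sum_(w <- net) \sum_(v <- net)
    (N%:R * tau < `|\sum_(o <- l) stat u w v o - N%:R * mean Z u w v|)%R%:R :> R.
Proof.
move=> sl nc; apply/negP => /negP; rewrite -ltNge => lt1; apply: nc => u w v un wn vn.
rewrite leNgt; apply/negP => h; move: lt1; apply/negP; rewrite -leNgt.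
have mem_le (F : 'cV[C]_d -> R) x : x \in net -> (forall x, 0 <= F x) ->
    F x <= \sum_(x <- net) F x.
  by move=> xn F0; rewrite (big_rem x) //= lerDl; exact: sumr_ge0.
apply: le_trans (mem_le _ u un _); last first.
  by move=> u'; apply: sumr_ge0 => w' _; apply: sumr_ge0 => v' _; rewrite ler0n.
apply: le_trans (mem_le _ w wn _); last first.
  by move=> w'; apply: sumr_ge0 => v' _; rewrite ler0n.
apply: le_trans (mem_le _ v vn _); last by move=> v'; rewrite ler0n.
by rewrite h.
Qed.

Lemma failure_le Z (B : R) : unitary Z -> B = 48 * 256 ^+ 3 * d%:R -> tau <= 1 ->
  1 - 2 * (size net)%:R ^+ 3 * expR (- (N%:R * tau ^+ 2 / (8 * B))) <=
  prob Z (fun V => pudist Z V <= 32 * tau) (rounds N estimate).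
Proof.
move=> hZ BE tau1.
have d0 : 0 < d%:R :> R by rewrite ltr0n.
have B0 : 0 < B by rewrite BE !mulr_gt0 ?exprn_gt0.
have p0 := @pZ_ge0 R k Z; have p1 := pZ_sum hZ.
rewrite /prob prob_rounds mxtraceZ mxtrace1 -[d%:R^-1]/(d%:R^-1) mulVf ?pnatr_eq0 //.
rewrite mul1r; set E := expR _.
pose bad u w v (l : seq (outcome k)) : R :=
  (N%:R * tau < `|\sum_(o <- l) stat u w v o - N%:R * mean Z u w v|)%R%:R.
have tail u w v : u \in net -> w \in net -> v \in net ->
    iidE (pZ Z) N (bad u w v) <= 2 * E.
  move=> un wn vn; rewrite /bad -(stat_mean u w v hZ); apply: chernoff => //.
  rewrite BE; apply: stat_moment => //; try exact: net_le1.
    by rewrite divr_ge0 // -BE mulr_ge0 // ltW.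
  move: (d%:R) d0 => D D0.
  (* The tilt used by [chernoff] must satisfy lam d <= 1/256, which tau <= 1 ensures. *)
  have -> : tau / (4 * (48 * 256 ^+ 3 * D)) * D = 256^-1 * (tau / (192 * 256 ^+ 2)).
    by field; rewrite gt_eqF.
  rewrite ler_piMr ?invr_ge0 // ler_pdivrMr ?mulr_gt0 ?exprn_gt0 // mul1r.
  by apply: le_trans tau1 _; rewrite -natrX -natrM ler1n.
(* Union bound: a failure forces inconsistency of Z with the data, hence at least one violated
   triple. *)
have union : 1 <= iidE (pZ Z) N (fun l => if `[< pudist Z (estimate l) <= 32 * tau >]
      then 1 else 0) +
    \sum_(u <- net) \sum_(w <- net) \sum_(v <- net) iidE (pZ Z) N (bad u w v).
  under [X in _ + X]eq_bigr => u _ do under eq_bigr => w _ do rewrite -iidE_sum.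
  under [X in _ + X]eq_bigr => u _ do rewrite -iidE_sum.
  rewrite -iidE_sum -iidED -[X in X <= _](iidE_cst p1 N 1).
  apply: le_iidE => // l sl.
  have bad0 : 0 <= \sum_(u <- net) \sum_(w <- net) \sum_(v <- net) bad u w v l.
    apply: sumr_ge0 => u _; apply: sumr_ge0 => w _; apply: sumr_ge0 => v _.
    by rewrite ler0n.
  case: asboolP => [_|nP]; first by rewrite lerDl.
  rewrite add0r; apply: (inconsistent_le sl) => cZ; apply: nP.
  apply: (consistent_pudist hZ (unitary_estimate l) cZ).
  exact: estimate_consistent hZ cZ.
rewrite lerBlDr; apply: le_trans union _; rewrite lerD2l.
have sum_le (F : 'cV[C]_d -> R) b : (forall x, x \in net -> F x <= b) ->
    \sum_(x <- net) F x <= (size net)%:R * b.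
  move=> h; apply: (@le_trans _ _ (\sum_(x <- net) b)).
    by rewrite big_seq [leRHS]big_seq; apply: ler_sum => x /h.
  by rewrite big_const_seq count_predT iter_addr_0 mulr_natl.
have -> : 2 * (size net)%:R ^+ 3 * E =
    (size net)%:R * ((size net)%:R * ((size net)%:R * (2 * E))) by ring.
apply: (sum_le) => u un; apply: (sum_le) => w wn; apply: (sum_le) => v vn.
exact: tail.
Qed.

End Estimator.

(** * Choice of constants and the final bound *)

Lemma ln2_ge (R : realType) (h : R) : 2 <= h -> 2^-1 <= ln h.
Proof.
move=> h2; have h0 : 0 < h by apply: lt_le_trans h2.
rewrite -ler_expR lnK ?posrE //; apply: le_trans h2.
have := expR_ge1Dx (- 2^-1 : R); have := expRxMexpNx_1 (2^-1 : R).
have := expR_gt0 (2^-1 : R); move: (expR _) (expR _) => e f; nra.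
Qed.

(** The round count is 64 d ln(1/eta) 8 B / tau^2 with B = 48 256^3 d and tau = eps / 32, whence
    1024 = 32^2. The summand 8 pays for rounding up. *)
Definition query_const : nat := (64 * 8 * 48 * 256 ^ 3 * 1024 + 8)%N.

Lemma query_constE (R : realType) :
  query_const%:R = 64 * 8 * 48 * 256 ^+ 3 * 1024 + 8 :> R.
Proof. by rewrite /query_const natrD 4!natrM natrX. Qed.

Lemma exponent_arith (d : nat) : (0 < d)%N ->
  [/\ (60 * d = 20 * d * 3)%N, ((60 * d).+1 <= 64 * d - 1)%N &
      ((64 * d - 1).+1 = 64 * d)%N].
Proof. by move=> d0; split; lia. Qed.

Lemma tomography_small_eps (R : realType) (k c : nat) (eps eta : R) :
  c%:R = 64 * 8 * 48 * 256 ^+ 3 * 1024 + 8 :> R ->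
  0 < eps -> eps < 2 -> 0 < eta -> eta <= 2^-1 ->
  exists a : alg R k.+1,
    wf_alg a /\
    ((queries a)%:R <= c%:R * (k.+1%:R ^+ 2 / eps ^+ 2) * ln (eta^-1)) /\
    (forall Z : 'M[complex R]_k.+1, unitary Z ->
       1 - eta <= prob Z (fun V => pudist Z V <= eps) a).
Proof.
move=> cE e0 e2 eta0 eta2; set d := k.+1.
have [net [net_size net1 net2]] := unit_net R (ltn0Sn k).
set h := eta^-1; have h2 : 2 <= h by rewrite -[2]invrK lef_pV2 ?posrE ?invr_gt0.
have h0 : 0 < h by rewrite invr_gt0.
set L := ln h; have L2 : 2^-1 <= L by exact: ln2_ge.
pose tau := eps / 32.
have [B BE] : exists B : R, B = 48 * 256 ^+ 3 * d%:R by eexists.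
have d1 : 1 <= d%:R :> R by rewrite ler1n.
have d0 : 0 < d%:R :> R by rewrite ltr0n.
have B0 : 0 < B by rewrite BE !mulr_gt0 ?exprn_gt0.
have tau0 : 0 < tau by rewrite divr_gt0.
(* With this many rounds the exponential tail is at most eta^(64 d), while 2 |net|^3 <= 2^(60 d + 1)
   <= eta^-(64 d - 1); the product is at most eta. *)
pose Q := 64 * d%:R * L * (8 * B) / tau ^+ 2.
have Q0 : 0 <= Q by rewrite divr_ge0 ?sqr_ge0 // !mulr_ge0 // ltW //; lra.
pose N := (Num.truncn Q).+1.
have /andP[N1 N2] : (Num.truncn Q)%:R <= Q < N%:R by exact: Num.Theory.truncn_itv.
exists (rounds N (estimate net tau N)); split; [|split].
- by apply: wf_rounds => l; exact: unitary_estimate.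
- apply: (@le_trans _ _ N%:R); first by rewrite ler_nat queries_rounds.
  rewrite /N -natr1; apply: (@le_trans _ _ (Q + 1)); first by rewrite lerD2r.
  set A := d%:R ^+ 2 / eps ^+ 2.
  (* From eps < 2 and d >= 1; with L >= 1/2 it gives 8 A L >= 1, which absorbs the rounding. *)
  have A4 : 4^-1 <= A.
    rewrite ler_pdivlMr ?exprn_gt0 //; apply: (@le_trans _ _ 1).
      by rewrite mulrC ler_pdivrMr // mul1r expr2; nra.
    by rewrite exprn_ege1.
  have QE : Q = 64 * 8 * 48 * 256 ^+ 3 * 1024 * A * L.
    rewrite /Q /tau BE /A; move: (256 : R) (d%:R) => y x.
    by field; rewrite gt_eqF.
  rewrite cE; move: (64 * 8 * 48 * 256 ^+ 3 * 1024) QE => c0 QE.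
  rewrite QE (_ : (c0 + 8) * A * L = c0 * A * L + 8 * A * L); last by ring.
  by rewrite lerD2l; nra.
move=> Z hZ.
have -> : eps = 32 * tau by rewrite /tau; field.
apply: le_trans (failure_le net1 net2 (ltW tau0) _ hZ BE _) => //; last first.
  by rewrite /tau; lra.
rewrite lerD2l lerN2.
have hE : expR (- (N%:R * tau ^+ 2 / (8 * B))) <= (h ^+ (64 * d))^-1.
  have -> : h ^+ (64 * d) = expR ((64 * d)%:R * L) by rewrite expRM_natl lnK ?posrE.
  rewrite -expRN ler_expR lerN2 natrM ler_pdivlMr ?mulr_gt0 //.
  by rewrite -ler_pdivrMr ?exprn_gt0 //; exact: ltW.
have [x1 x2 x3] := exponent_arith (ltn0Sn k); rewrite -/d in x1 x2 x3.
have hS : 2 * (size net)%:R ^+ 3 <= h ^+ (64 * d - 1).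
  apply: (@le_trans _ _ (2 ^+ (60 * d).+1)).
    rewrite [2 ^+ _]exprS ler_pM2l // -natrX -natrX ler_nat.
    by rewrite x1 expnM leq_exp2r.
  apply: (@le_trans _ _ (h ^+ (60 * d).+1)).
    by rewrite lerXn2r ?nnegrE // ltW.
  by apply: ler_weXn2l; [apply: le_trans h2; lra|exact: x2].
apply: (@le_trans _ _ (h ^+ (64 * d - 1) * (h ^+ (64 * d))^-1)).
  by apply: ler_pM => //; rewrite ?expR_ge0 ?mulr_ge0 ?exprn_ge0 ?ler0n.
have -> : h ^+ (64 * d) = h ^+ (64 * d - 1) * h.
  by rewrite -exprSr; rewrite x3.
rewrite invfM mulrA divff ?mul1r /h ?invrK //.
by rewrite expf_neq0 // invr_neq0 // gt_eqF.
Qed.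

Theorem mainTheorem5 :
  exists c : nat, forall (R : realType) (d : nat), (0 < d)%N ->
  forall eps eta : R, 0 < eps -> 0 < eta -> eta <= 2^-1 ->
  exists a : alg R d,
    wf_alg a /\
    ((queries a)%:R <= c%:R * (d%:R ^+ 2 / eps ^+ 2) * ln (eta^-1)) /\
    (forall Z : 'M[complex R]_d, unitary Z ->
       1 - eta <= prob Z (fun V => pudist Z V <= eps) a).
Proof.
exists query_const => R [//|k] _ eps eta e0 eta0 eta2.
have [e2|e2] := ltP eps 2; first exact: tomography_small_eps (query_constE R) _ _ _ _.
(* For eps >= 2 the identity is a valid answer without any query, by [pudist_le2]. *)
exists (Output 1%:M); split; [exact: unitary1|split].
  apply: mulr_ge0; first by rewrite mulr_ge0 ?divr_ge0 ?sqr_ge0 ?ler0n.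
  apply: (@le_trans _ _ 2^-1); first by rewrite invr_ge0.
  by apply: ln2_ge; rewrite -[2]invrK lef_pV2 ?posrE ?invr_gt0.
move=> Z hZ; rewrite /prob /=; case: asboolP => [_|[]]; last first.
  by apply: le_trans e2; apply: pudist_le2 => //; exact: unitary1.
rewrite mxtraceZ mxtrace1 mulVf ?pnatr_eq0 //= lerBlDr lerDl; exact: ltW.
Qed.
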